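(* Let $G=(V,E)$ be a locally finite directed graph, and suppose there is a partition $(S_k:k\in\mathbb{Z})$ of $V$ such that: (A1) for all $k\in\mathbb{Z}$ and $x\in S_k$, $\mathrm{Out}(x)\subset S_{k+1}$; (A2) there is a graph automorphism $\phi$ of $G$ that maps $S_k$ to $S_{k+2}$ for every $k$, and such that $\mathrm{Out}(x)=\mathrm{In}(\phi(x))$ for all $x\in V$. For $k\in\mathbb{Z}$ let $D_k$ be the undirected graph with vertex set $S_k\cup S_{k+1}$ and an undirected edge between $x$ and $y$ whenever $(x,y)$ is a directed edge of $G$ (the graphs $D_k$ are all isomorphic), and let $D$ be a graph isomorphic to every $D_k$. Let $\lambda>0$. If there is a unique Gibbs distribution for the hard-core model on $D$ with activity $\lambda$, then the trapping game on $G$ with $p=1/(1+\lambda)$ has probability $0$ of a draw (from every vertex).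
   Context: For a vertex $x$ of a directed graph, $\mathrm{Out}(x)$ and $\mathrm{In}(x)$ denote its sets of out-neighbours and in-neighbours. **Trapping game on $G$ with parameter $p$.** Each vertex is independently a *trap* with probability $p$ and *open* with probability $1-p$. A token starts at some vertex; two players, who both know the whole configuration, move alternately. If the token is at $x$, a move consists of moving it to an open vertex in $\mathrm{Out}(x)$; if all vertices in $\mathrm{Out}(x)$ are traps, the player to move loses. A strategy for a player is a map assigning a legal move, where one exists, to each vertex; a winning strategy is one that results in a win for that player (in finitely many moves) whatever strategy the other player uses. The game from a vertex is a *draw* if neither player has a winning strategy. (By convention, if the starting vertex is a trap the game from it is regarded as a win for the first player.) **Hard-core model.** For an undirected graph with vertex set $W$ and $\lambda>0$, a Gibbs distribution for the hard-core model with activity $\lambda$ is a probability distribution of a configuration $\eta\in\{0,1\}^W$ such that, for every $v\in W$, $\mathbb{P}(\eta(v)=1\mid (\eta(w):w\ne v))$ equals $\frac{\lambda}{1+\lambda}$ if $\eta(w)=0$ for all neighbours $w$ of $v$, and equals $0$ otherwise. *)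

(* Defs.v *)
From HB Require Import structures.
From mathcomp Require Import all_boot all_order all_algebra finmap.
From mathcomp Require Import all_classical all_reals all_analysis.

Set Implicit Arguments.
Unset Strict Implicit.
Unset Printing Implicit Defensive.

Import Order.TTheory GRing.Theory Num.Theory.

Local Open Scope classical_set_scope.
Local Open Scope ring_scope.

(** A directed graph on [V] is a relation [E]: [E x y] is an edge from [x] to [y]. *)

Definition Out (V : choiceType) (E : rel V) (x : V) : set V := [set y | E x y].
Definition In (V : choiceType) (E : rel V) (x : V) : set V := [set y | E y x].

Definition locally_finite (V : choiceType) (E : rel V) : Prop :=
  forall x, finite_set (Out E x) /\ finite_set (In E x).

Definition graph_iso (V W : choiceType) (E : rel V) (F : rel W) (f : V -> W)
    : Prop :=
  bijective f /\ forall x y, F (f x) (f y) = E x y.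

Definition isomorphic (V W : choiceType) (E : rel V) (F : rel W) : Prop :=
  exists f : V -> W, graph_iso E F f.

Definition automorphism (V : choiceType) (E : rel V) (f : V -> V) : Prop :=
  graph_iso E E f.

Definition is_partition (V : choiceType) (S : int -> set V) : Prop :=
  trivIset [set: int] S /\ \bigcup_k S k = [set: V].

Definition condA1 (V : choiceType) (E : rel V) (S : int -> set V) : Prop :=
  forall k x, S k x -> Out E x `<=` S (k + 1).

Definition condA2 (V : choiceType) (E : rel V) (S : int -> set V) : Prop :=
  exists phi : V -> V,
    [/\ automorphism E phi,
        forall k, phi @` S k = S (k + 2)
      & forall x, Out E x = In E (phi x)].

(** The vertex set and the (symmetric) adjacency relation of [D_k]. *)
Definition Dvertex (V : choiceType) (S : int -> set V) (k : int) : choiceType :=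
  {x : V | x \in S k `|` S (k + 1)}.

Definition Dadj (V : choiceType) (E : rel V) (S : int -> set V) (k : int)
    : rel (Dvertex S k) :=
  fun x y => E (val x) (val y) || E (val y) (val x).

Definition legal_move (V : choiceType) (E : rel V) (trap : set V) (x y : V)
    : Prop :=
  Out E x y /\ ~ trap y.

Definition stuck (V : choiceType) (E : rel V) (trap : set V) (x : V) : Prop :=
  Out E x `<=` trap.

(** The value of a strategy at a vertex without legal move is irrelevant. *)
Definition is_strategy (V : choiceType) (E : rel V) (trap : set V)
    (s : V -> V) : Prop :=
  forall x, (exists y, legal_move E trap x y) -> legal_move E trap x (s x).

(** Position after [n] moves; the first player makes the moves [1, 3, 5, ...].
    Only meaningful up to the first stuck position. *)
Fixpoint play (V : choiceType) (s1 s2 : V -> V) (x : V) (n : nat) : V :=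
  if n is m.+1 then (if odd m then s2 else s1) (play s1 s2 x m) else x.

(** The player to move at the first stuck position loses, so the first player
    wins iff this position is reached after an odd number of moves.
    [first = true] stands for the first player, [false] for the second. *)
Definition wins_play (V : choiceType) (E : rel V) (trap : set V)
    (first : bool) (s1 s2 : V -> V) (x : V) : Prop :=
  exists n : nat,
    [/\ stuck E trap (play s1 s2 x n),
        forall m : nat, (m < n)%N -> ~ stuck E trap (play s1 s2 x m)
      & odd n = first].

(** A trap as starting vertex counts as a win for the first player. *)
Definition first_player_wins (V : choiceType) (E : rel V) (trap : set V)
    (x : V) : Prop :=
  trap x \/
  exists s1, is_strategy E trap s1 /\
    forall s2, is_strategy E trap s2 -> wins_play E trap true s1 s2 x.

Definition second_player_wins (V : choiceType) (E : rel V) (trap : set V)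
    (x : V) : Prop :=
  ~ trap x /\
  exists s2, is_strategy E trap s2 /\
    forall s1, is_strategy E trap s1 -> wins_play E trap false s1 s2 x.

Definition draw (V : choiceType) (E : rel V) (trap : set V) (x : V) : Prop :=
  ~ first_player_wins E trap x /\ ~ second_player_wins E trap x.

(** [trap omega] is the random set of traps; mutual independence of the events
    [v is a trap] is the product rule over all finite sets of vertices. *)
Definition independent_traps (R : realType) (V : choiceType)
    (d : measure_display) (Omega : measurableType d) (P : probability Omega R)
    (p : R) (trap : Omega -> set V) : Prop :=
  [/\ forall v, measurable [set omega | trap omega v],
      forall v, P [set omega | trap omega v] = p%:E
    & forall A : {fset V},
        P [set omega | forall v, v \in A -> trap omega v] =
        (\prod_(v <- A) P [set omega | trap omega v])%E].

(** Events [eta v = 1] for [v] in [A]; they generate the sigma-algebra of the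
    coordinates in [A]. *)
Definition occupied_events (W : choiceType) (A : set W) : set (set (W -> bool)) :=
  [set [set eta : W -> bool | eta v] | v in A].

(** {0,1}^W with the product sigma-algebra. *)
Notation config W := (g_sigma_algebraType (@occupied_events W [set: _])).

(** [g] is a version of the conditional probability of [A] given the
    sigma-algebra [F]. *)
Definition is_cond_prob (R : realType) (d : measure_display)
    (T : measurableType d) (mu : probability T R) (F : set (set T)) (A : set T)
    (g : T -> R) : Prop :=
  (forall B : set R, measurable B -> F (g @^-1` B)) /\
  (forall B : set T, F B -> mu (A `&` B) = (\int[mu]_(t in B) (g t)%:E)%E).

Definition hardcore_kernel (R : realType) (W : choiceType) (adj : rel W)
    (lambda : R) (v : W) (eta : W -> bool) : R :=
  if `[< forall w, adj v w -> eta w = false >] then lambda / (1 + lambda) else 0.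

Definition is_gibbs (R : realType) (W : choiceType) (adj : rel W) (lambda : R)
    (mu : probability (config W) R) : Prop :=
  forall v : W,
    is_cond_prob mu <<s occupied_events [set w | w != v] >>
      [set eta | eta v] (hardcore_kernel adj lambda v).

(** Functions underlying measures are unconstrained outside measurable sets,
    hence the restriction to measurable [A]. *)
Definition unique_gibbs (R : realType) (W : choiceType) (adj : rel W)
    (lambda : R) : Prop :=
  exists mu : probability (config W) R,
    is_gibbs adj lambda mu /\
    forall nu : probability (config W) R, is_gibbs adj lambda nu ->
      forall A : set (config W), measurable A -> nu A = mu A.

(* Main.v *)
Require Import Defs.
From HB Require Import structures.
From mathcomp Require Import all_boot all_order all_algebra finmap.
From mathcomp Require Import all_classical all_reals all_analysis.
From mathcomp Require Import measurable_realfun zify ring lra.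

Set Implicit Arguments.
Unset Strict Implicit.
Unset Printing Implicit Defensive.

Import Order.TTheory GRing.Theory Num.Theory.

Local Open Scope classical_set_scope.
Local Open Scope ring_scope.

(** Code a position as 1 if it is open and lost for the player to move, and as 0 if it is a
    trap or won for that player: an open vertex is a 1 iff all its out-neighbours are 0. Draws
    can be coded consistently in two ways, as 1 on the levels of one parity and 0 on the
    others. Both codings restricted to the layers [k] and [k + 1] have a hard-core Gibbs law on
    [D_k]: each is the limit of games with extra traps outside the orbit under [phi] of a finite
    volume. Since [Out x = In (phi x)], going down the levels of such a game amounts to
    alternate heat-bath updates of the two layers of a finite hard-core model; these preserve
    the hard-core measure and, because all sites may be emptied at once, forget their
    starting point. If the Gibbs distribution is unique, the two codings, which are
    comparable and differ exactly at draws, agree almost surely. *)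

(** * Values of positions *)

(** Call the vertices with [par] true the 1-side, the others the 0-side. For a site [x] of [D_k],
    the vertices [iter m phi x] supply one fresh coin per sweep, so all levels from [k] upwards
    serve as space-time of a dynamics on [D_k]. In infinite volume this dynamics has no starting
    time, so the Gibbs identity is proved in finite volumes, which must then approximate the true
    coding. Two opposite monotonicities make this possible: a deeper search lowers values on the
    1-side and raises them on the 0-side, while extra traps on the 0-side do the reverse. A
    finite-volume value that is right at one depth is therefore right at all larger depths. Hence
    the volume can be fixed first, and the number of sweeps then taken as large as the relaxation in
    that volume demands. *)

(* [par] marks the vertices where an undecided position counts as 1; [hv n] is the value
   obtained by searching the game to depth [n]. *)
Fixpoint hv (V : choiceType) (E : rel V) (par : V -> bool) (T : set V)
    (n : nat) (x : V) : bool :=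
  if n is m.+1 then `[< ~ T x /\ forall y, E x y -> hv E par T m y = false >]
  else par x.

(** For alternating [par] the values decrease with the depth on the 1-side and increase on the
    0-side, so these are their limits. *)
Definition hvlim (V : choiceType) (E : rel V) (par : V -> bool) (T : set V)
    (x : V) : bool :=
  if par x then `[< forall n, hv E par T n x >] else `[< exists n, hv E par T n x >].

Definition alternating (V : choiceType) (E : rel V) (par : V -> bool) : Prop :=
  forall x y, E x y -> par y = ~~ par x.

Section Values.
Variables (V : choiceType) (E : rel V) (par : V -> bool).
Hypothesis parE : alternating E par.
Implicit Types (T : set V) (x y : V) (n m : nat).

Lemma hvP T n x :
  reflect (~ T x /\ forall y, E x y -> hv E par T n y = false)
          (hv E par T n.+1 x).
Proof. exact: asboolP. Qed.

(** The condition on [par] covers depth 0, where traps are not looked at. *)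
Lemma hv_trap T n x : T x -> par x = false -> hv E par T n x = false.
Proof. by case: n => [//|n] Tx _; apply/hvP => -[]. Qed.

Lemma hv_antitone T n m x :
  (forall y, E x y -> hv E par T n y -> hv E par T m y) ->
  hv E par T m.+1 x -> hv E par T n.+1 x.
Proof.
move=> h /hvP[Tx H]; apply/hvP; split=> // y Exy.
by apply/negP => /(h _ Exy); rewrite H.
Qed.

(** The recursion reverses inequalities and [par] flips along each edge, so both directions
    propagate from depth 0, where every value is extremal. *)
Lemma hv_step T n x :
  if par x then hv E par T n.+1 x -> hv E par T n x
  else hv E par T n x -> hv E par T n.+1 x.
Proof.
elim: n x => [|n IHn] x; first by rewrite /=; case: (par x).
by case: ifP => px; apply: hv_antitone => y Exy; have := IHn y; rewrite (parE Exy) px.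
Qed.

Lemma hv_le T n m x : (n <= m)%N ->
  if par x then hv E par T m x -> hv E par T n x
  else hv E par T n x -> hv E par T m x.
Proof.
elim: m => [|m IHm]; first by rewrite leqn0 => /eqP ->; case: ifP.
rewrite leq_eqVlt => /orP[/eqP ->|]; first by case: ifP.
rewrite ltnS => /IHm; have := hv_step T m x.
by case: ifP => _ h1 h2 h3; auto.
Qed.

Lemma hv_le_true T n m x : (n <= m)%N -> par x -> hv E par T m x -> hv E par T n x.
Proof. by move=> nm px; have := hv_le T x nm; rewrite px. Qed.

Lemma hv_le_false T n m x : (n <= m)%N -> par x = false ->
  hv E par T n x -> hv E par T m x.
Proof. by move=> nm px; have := hv_le T x nm; rewrite px. Qed.

(** The extra traps force zeros on the 0-side only, which favours ones on the 1-side; the recursion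
    preserves this order. *)
Lemma hv_le_trap T T' n x : T `<=` T' -> (forall y, T' y -> par y -> T y) ->
  if par x then hv E par T n x -> hv E par T' n x
  else hv E par T' n x -> hv E par T n x.
Proof.
move=> sub subp; elim: n x => [|n IHn] x; first by case: ifP.
case: ifP => px /hvP[Tx H]; apply/hvP; split.
- by move=> /subp; rewrite px => /(_ isT).
- move=> y Exy; have := IHn y; rewrite (parE Exy) px /= => h.
  by apply/negP => /h; rewrite H.
- by move=> /sub.
- move=> y Exy; have := IHn y; rewrite (parE Exy) px /= => h.
  by apply/negP => /h; rewrite H.
Qed.

(** On the 1-side, [hvlim] is at most the value for [T] at depth [n], this at most the one for [T']
    at depth [n], and this at most the one for [T'] at depth [N]; both ends coincide. On the 0-side
    the order is reversed. *)
Lemma hv_sandwich T T' N n x : T `<=` T' -> (forall y, T' y -> par y -> T y) ->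
  hv E par T' N x = hv E par T N x -> hv E par T N x = hvlim E par T x ->
  (N <= n)%N -> hv E par T' n x = hvlim E par T x.
Proof.
move=> s1 s2 e1 e2 Nn; have := hv_le T' x Nn; have := hv_le_trap n x s1 s2.
rewrite e1 e2 /hvlim; case: ifP => px h1 h2; apply/idP/idP => //.
- by move=> /asboolP H; apply: h1.
- by move=> h; apply/asboolP; exists n; apply: h1.
Qed.

Lemma hvlim_step T n x : hv E par T n x = hvlim E par T x ->
  hv E par T n.+1 x = hvlim E par T x.
Proof. by move=> h; apply: (hv_sandwich (N := n)) => //; rewrite ?leqnSn. Qed.

Lemma hvlim_cvg T x : exists n, hv E par T n x = hvlim E par T x.
Proof.
rewrite /hvlim; case: ifP => px.
- have [h|h] := pselect (forall n, hv E par T n x).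
    by exists 0%N; rewrite h; apply/esym/asboolP.
  have /existsNP[n /negP nh] := h; exists n.
  by rewrite (negbTE nh); apply/esym/asboolP.
- have [h|h] := pselect (exists n, hv E par T n x).
    by have [n hn] := h; exists n; rewrite hn; apply/esym/asboolP.
  exists 0%N; rewrite (asboolF h); apply/negP => h0; apply: h; by exists 0%N.
Qed.

End Values.

Lemma alternatingN (V : choiceType) (E : rel V) (par : V -> bool) :
  alternating E par -> alternating E (negb \o par).
Proof. by move=> h x y /h /= ->. Qed.


Section Game.
Variables (V : choiceType) (E : rel V) (par : V -> bool) (T : set V).
Hypothesis parE : alternating E par.

Lemma hvN_le n x :
  if par x then hv E (negb \o par) T n x -> hv E par T n x
  else hv E par T n x -> hv E (negb \o par) T n x.
Proof.
elim: n x => [|n IHn] x; first by rewrite /=; case: (par x).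
by case: ifP => px /hvP[Tx H]; apply/hvP; split=> // y Exy;
  have := IHn y; rewrite (parE Exy) px /= => h; apply/negP => /h; rewrite H.
Qed.

Lemma hvlimN_le x : par x -> hvlim E (negb \o par) T x -> hvlim E par T x.
Proof.
move=> px; rewrite /hvlim /= px /= => /asboolP[n hn]; apply/asboolP => m.
apply: (hv_le_true parE (leq_maxr n m)) => //.
have := hvN_le (maxn n m) x; rewrite px; apply.
by apply: (hv_le_false (alternatingN parE) (leq_maxl n m)); rewrite //= px.
Qed.

(** * Strategies *)

(** The second branch makes this a strategy even where no move is good; the last one is a dummy at
    stuck positions. *)
Definition greedy (good : V -> V -> Prop) (x : V) : V :=
  if pselect (exists y, legal_move E T x y /\ good x y) is left h then projT1 (cid h)
  else if pselect (exists y, legal_move E T x y) is left h then projT1 (cid h)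
  else x.

Lemma greedy_strategy good : is_strategy E T (greedy good).
Proof.
move=> x h; rewrite /greedy; case: pselect => [h1|_]; first by case: cid => y [].
by case: pselect => // h2; case: cid.
Qed.

Lemma greedy_good (good : V -> V -> Prop) x :
  (exists y, legal_move E T x y /\ good x y) ->
  legal_move E T x (greedy good x) /\ good x (greedy good x).
Proof. by move=> h; rewrite /greedy; case: pselect => // h1; case: cid. Qed.

Lemma not_stuckP x : ~ stuck E T x <-> exists y, legal_move E T x y.
Proof.
split=> [h|[y [Exy Ty]] h]; last exact/Ty/h.
apply: contrapT => h'; apply: h => y Exy; apply: contrapT => Ty.
by apply: h'; exists y.
Qed.

Section Plays.
Variables (f : bool) (sa sb : V -> V) (x0 : V).
Let run := play (if f then sa else sb) (if f then sb else sa) x0.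

Lemma runS m : run m.+1 = (if odd m (+) f then sa else sb) (run m).
Proof. by rewrite /run /=; case: (odd m); case: (f). Qed.

Let inv (I : bool -> nat -> V -> Prop) :=
  [/\ I f 0%N x0,
     forall m x, I true m x -> ~ stuck E T x -> I false m.+1 (sa x)
   & forall m x, I false m x -> ~ stuck E T x -> I true m.+1 (sb x)].

(** One argument serves either seat: [sa] belongs to the player being followed, who moves first iff
    [f], and the boolean index of [I] tells whether that player is to move. *)
Lemma run_inv I : inv I -> forall n,
  (forall m, (m < n)%N -> ~ stuck E T (run m)) -> I (odd n (+) f) n (run n).
Proof.
move=> [I0 Ia Ib]; elim=> [|n IHn] h; first by rewrite addFb.
have {}IHn := IHn (fun m mn => h m (ltnW mn)); have nst := h n (ltnSn n).
by rewrite runS oddS addNb; move: IHn; case: (_ (+) _) => IHn /=; auto.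
Qed.

End Plays.

(* At an attacking position with [~~ hv n.+1] some out-neighbour has [hv n]; for the
   least such [n] it serves all larger ones too, so the rank drops at each move. *)
Definition attack := greedy (fun x y => forall n, ~~ hv E par T n.+1 x -> hv E par T n y).

Lemma attack_good n x : ~ T x -> par x -> ~~ hv E par T n x ->
  legal_move E T x (attack x) /\
  forall n, ~~ hv E par T n.+1 x -> hv E par T n (attack x).
Proof.
move=> Tx px hn; apply: greedy_good.
have ex : exists n, ~~ hv E par T n.+1 x.
  exists n; apply: contra hn; apply: hv_le_true => //; exact: leqnSn.
case: (ex_minnP ex) => m hm mmin.
have [y [Exy hy]] : exists y, E x y /\ hv E par T m y.
  apply: contrapT => h; move/negP: hm; apply; apply/hvP; split=> // y Exy.
  by apply/negP => hy; apply: h; exists y.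
have py : par y = false by rewrite (parE Exy) px.
exists y; split; last by move=> k /mmin mk; apply: hv_le_false mk _ _.
split=> // Ty; by rewrite hv_trap in hy.
Qed.

(** The attacker moves at 1-side vertices of value 0, the defender at 0-side vertices of value 1.
    The depth witnessing this drops at every move and cannot be 0, where the value is [par]; so play
    stops within [N] moves, and never at the attacker's turn. *)
Lemma attack_wins f x N : ~ T x -> par x = f -> hv E par T N x = ~~ f ->
  exists sa, is_strategy E T sa /\ forall sb, is_strategy E T sb ->
    wins_play E T f (if f then sa else sb) (if f then sb else sa) x.
Proof.
move=> Tx px hx; exists attack; split; first exact: greedy_strategy.
move=> sb sbs.
pose I b m y := [/\ ~ T y, par y = b &
  exists j, (j + m <= N)%N /\ hv E par T j y = ~~ b].
pose run := play (if f then attack else sb) (if f then sb else attack) x.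
have runI n : (forall m, (m < n)%N -> ~ stuck E T (run m)) -> I (odd n (+) f) n (run n).
  apply: (@run_inv f attack sb x I); split.
  - by split=> //; exists N; rewrite addn0.
  - move=> m y [Ty py [[|j] [jm hj]]] _; first by rewrite /= py in hj.
    have [[Ey Ty'] h] := attack_good Ty py (negbT hj).
    split=> //; first by rewrite (parE Ey) py.
    by exists j; rewrite h ?hj //; split=> //; lia.
  - move=> m y [Ty py [[|j] [jm hj]]] /not_stuckP/sbs [Ey Ty']; first by rewrite /= py in hj.
    split=> //; first by rewrite (parE Ey) py.
    exists j; split; first lia.
    by move/hvP : hj => [_ ->].
have ex : exists n, `[< stuck E T (run n) >].
  apply: contrapT => h; have := runI N.+1; case.
    by move=> m _ s; apply: h; exists m; apply/asboolP.
  by move=> _ _ [j [jN _]]; lia.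
case: (ex_minnP ex) => n /asboolP nst nmin.
have nmin' m : (m < n)%N -> ~ stuck E T (run m).
  by move=> mn /asboolP /nmin; rewrite leqNgt mn.
exists n; split=> //; have := runI n nmin'.
case e: (odd n (+) f); last by move: e; case: (odd n); case: (f).
move=> [Ty py [j [_ /negbT hj]]]; exfalso.
have [lm _] := attack_good Ty py hj.
by have /not_stuckP := ex_intro _ _ lm; apply.
Qed.

Hypothesis outs : forall x, exists s : seq V, forall y, (y \in s) = E x y.

(** Compactness: if each of the finitely many out-neighbours fell to 0 at some depth, all would be 0
    at a common depth [N], and [x] would be 1 at depth [N.+1]. *)
Lemma hv_false_inf x : ~ T x -> par x = false -> (forall n, hv E par T n x = false) ->
  exists y, legal_move E T x y /\ forall n, hv E par T n y.
Proof.
move=> Tx px hx; have [s sE] := outs x; apply: contrapT => h.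
have {h} h y : E x y -> exists n, hv E par T n y = false.
  move=> Exy; apply: contrapT => h'.
  have hy n : hv E par T n y by apply: contrapT => /negP/negbTE hn; apply: h'; exists n.
  by apply: h; exists y; split=> //; split=> //; have /hvP[] := hy 1%N.
have [N hN] : exists N, forall y, y \in s -> hv E par T N y = false.
  have : {subset s <= [pred y | E x y]} by move=> y; rewrite sE.
  elim: (s) => [|y t IHt] st; first by exists 0%N.
  have [N hN] : exists N, forall y, y \in t -> hv E par T N y = false.
    by apply: IHt => z zt; apply: st; rewrite inE zt orbT.
  have Exy : E x y by apply: (st y); rewrite mem_head.
  have [n hn] := h y Exy; exists (maxn n N) => z zs.
  have pz : par z by rewrite (parE (st z zs)) px.
  move: zs; rewrite inE => /orP[/eqP ez|zt]; apply/negP => hz.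
    by have := hv_le_true parE (leq_maxl n N) pz hz; rewrite ez hn.
  by have := hv_le_true parE (leq_maxr n N) pz hz; rewrite hN.
have /negP := negbT (hx N.+1); apply; apply/hvP; split=> // y Exy.
by apply: hN; rewrite sE.
Qed.

(** The evading player goes from an undecided 0-side vertex to an undecided 1-side one, and every
    reply leads back. The opponent may still get stuck, so the claim is only that the evader does
    not lose. *)
Lemma evade_survives f x : par x = ~~ f -> ~ T x -> (forall n, hv E par T n x = par x) ->
  exists sa, is_strategy E T sa /\ forall sb, is_strategy E T sb ->
    ~ wins_play E T (~~ f) (if f then sa else sb) (if f then sb else sa) x.
Proof.
move=> px Tx hx; pose good (x y : V) := forall n, hv E par T n y.
exists (greedy good); split; first exact: greedy_strategy.
move=> sb sbs; pose run := play (if f then greedy good else sb) (if f then sb else greedy good) x.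
move=> [n [nst nmin nf]].
pose I b (m : nat) y := [/\ ~ T y, par y = ~~ b & forall n, hv E par T n y = ~~ b].
have : I (odd n (+) f) n (run n).
  apply: (@run_inv f (greedy good) sb x I) => //; split.
  - by split=> // k; rewrite hx.
  - move=> m y [Ty py hy] _; have [[Ey Ty'] h] := greedy_good (hv_false_inf Ty py hy).
    by split=> //; rewrite (parE Ey) py.
  - move=> m y [Ty py hy] /not_stuckP/sbs [Ey Ty']; split=> //; first by rewrite (parE Ey) py.
    by move=> k; have /hvP[_ ->] := hy k.+1.
rewrite nf; have -> : ~~ f (+) f = true by case: (f).
move=> [Ty py hy]; have [y [lm _]] := hv_false_inf Ty py hy.
by have /not_stuckP := ex_intro _ _ lm; apply.
Qed.

End Game.

(** Each coding detects one winner at [x]: under [par] the value 0 is a first-player win, under its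
    negation the value 1 is a second-player win. An undecided value lets the other player evade. *)
Lemma draw_hvlim (V : choiceType) (E : rel V) (par : V -> bool) (T : set V) x :
  alternating E par -> (forall x, exists s : seq V, forall y, (y \in s) = E x y) ->
  par x -> draw E T x <-> hvlim E par T x && ~~ hvlim E (negb \o par) T x.
Proof.
move=> parE outs px; have parE' := alternatingN parE.
rewrite /hvlim /= px /=; split.
- move=> [nf ns]; have Tx : ~ T x by move=> Tx; apply: nf; left.
  apply/andP; split.
    apply/asboolP => n; apply: contrapT => /negP/negbTE hn; apply: nf; right.
    have [s [ss sw]] := @attack_wins V E par T parE true x n Tx px hn.
    by exists s.
  apply/asboolP => -[n hn]; apply: ns; split=> //.
  have pxF : (negb \o par) x = false by rewrite /= px.
  have [s [ss sw]] := @attack_wins V E _ T parE' false x n Tx pxF hn.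
  by exists s.
- move=> /andP[/asboolP h1 /asboolP h2].
  have Tx : ~ T x by have /hvP[] := h1 1%N.
  split.
    case=> // -[s1 [s1s s1w]].
    have h n : hv E par T n x = par x by rewrite h1 px.
    have [s2 [s2s]] := evade_survives parE outs (f := false) px Tx h.
    by move=> /(_ s1 s1s); apply; apply: s1w.
  move=> [_ [s2 [s2s s2w]]].
  have pxF : (negb \o par) x = ~~ true by rewrite /= px.
  have h n : hv E (negb \o par) T n x = (negb \o par) x.
    by rewrite pxF; apply/negP => hn; apply: h2; exists n.
  have [s1 [s1s]] := evade_survives parE' outs (f := true) pxF Tx h.
  by move=> /(_ s2 s2s); apply; apply: s2w.
Qed.

(** * The hard-core model in finite volume *)

Section HeatBath.
Variables (R : realFieldType) (I : finType) (e : rel I) (lam : R).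
Hypothesis lam_gt0 : 0 < lam.
Hypothesis e_sym : symmetric e.
Hypothesis e_irr : irreflexive e.

Local Notation config := {ffun I -> bool}.
Implicit Types (s : config) (d : I) (ds : seq I) (f : config -> R).

Let p := 1 / (1 + lam).
Let q := lam / (1 + lam).

Let lam1_neq0 : 1 + lam != 0. Proof. by rewrite gt_eqF // addr_gt0. Qed.
Let p_gt0 : 0 < p. Proof. by rewrite divr_gt0 // addr_gt0. Qed.
Let q_gt0 : 0 < q. Proof. by rewrite divr_gt0 // addr_gt0. Qed.
Let pq1 : q + p = 1. Proof. by rewrite /p /q; field. Qed.

Definition free d s := [forall d', e d d' ==> ~~ s d'].

Definition set_site d (b : bool) s : config :=
  [ffun d' => if d' == d then b else s d'].

Definition update d (b : bool) s := set_site d (b && free d s) s.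

(* Expectation of [f] after heat-bath updates at the sites of [ds], in this order. *)
Fixpoint heat_bath (ds : seq I) f s : R :=
  if ds is d :: ds' then
    lam / (1 + lam) * heat_bath ds' f (update d true s)
    + 1 / (1 + lam) * heat_bath ds' f (update d false s)
  else f s.

Definition weight s : R :=
  if [forall x, forall y, e x y ==> ~~ (s x && s y)]
  then \prod_x (if s x then lam else 1) else 0.

Definition hc_sum f : R := \sum_s weight s * f s.

Lemma free_set_site d b s : free d (set_site d b s) = free d s.
Proof.
apply: eq_forallb => d'; rewrite ffunE; case: eqP => // ->.
by rewrite e_irr.
Qed.

Lemma weight_set_true d s : s d = false ->
  weight (set_site d true s) = (if free d s then lam * weight s else 0).
Proof.
move=> sd; rewrite /weight.
have -> : [forall x, forall y, e x y ==> ~~ (set_site d true s x && set_site d true s y)]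
   = free d s && [forall x, forall y, e x y ==> ~~ (s x && s y)].
  apply/idP/andP => [/'forall_forallP h|[/forallP hf /'forall_forallP h]].
    split.
      apply/forallP => y; apply/implyP => edy; have := h d y.
      rewrite edy !ffunE eqxx /=; case: eqP => [yd|//].
      by rewrite yd e_irr in edy.
    apply/'forall_forallP => x y; apply/implyP => exy; have := h x y.
    rewrite exy !ffunE /=; case: (x =P d) => [->|_]; first by rewrite sd.
    by case: (y =P d) => [->|_]; first by rewrite sd andbF.
  apply/'forall_forallP => x y; apply/implyP => exy.
  rewrite !ffunE; case: (x =P d) => [xd|_]; case: (y =P d) => [yd|_].
  - by rewrite xd yd e_irr in exy.
  - by have := hf y; rewrite -xd exy.
  - by have := hf x; rewrite -yd e_sym exy andbT.
  - by have := h x y; rewrite exy.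
case: (free d s) => //=; case: ifP => _; last by rewrite mulr0.
rewrite (bigD1 d) //= [X in _ = _ * X](bigD1 d) //= sd mul1r ffunE eqxx; congr (_ * _).
by apply: eq_bigr => x /negbTE xd; rewrite ffunE xd.
Qed.

Lemma sum_site d (F : config -> R) :
  \sum_s F s = \sum_(s : config | ~~ s d) (F s + F (set_site d true s)).
Proof.
rewrite big_split /= (bigID (fun s : config => ~~ s d)) /=; congr (_ + _).
rewrite (reindex_onto (set_site d true) (set_site d false)) /=; last first.
  move=> s; rewrite negbK => sd; apply/ffunP => x; rewrite !ffunE.
  by case: eqP => // ->.
apply: eq_bigl => s; rewrite negbK !ffunE eqxx /=; apply/eqP/idP.
  by move=> <-; rewrite ffunE eqxx.
move=> sd; apply/ffunP => x; rewrite !ffunE; case: eqP => // ->.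
by rewrite (negbTE sd).
Qed.

(** An update at [d] mixes only the two states of [d]. If [d] is free, their total weight
    [(1 + lam) * weight s] is redistributed in the proportions it already had; otherwise the
    occupied state has weight 0. *)
Lemma heat_bath_invariant ds f : hc_sum (heat_bath ds f) = hc_sum f.
Proof.
elim: ds => [|d ds IHds] //; rewrite -{}IHds; set g := heat_bath ds f.
rewrite /hc_sum !(sum_site d); apply: eq_bigr => s sd.
have s0 : set_site d false s = s.
  by apply/ffunP => x; rewrite ffunE; case: eqP => // ->; rewrite (negbTE sd).
have ss b b' : set_site d b (set_site d b' s) = set_site d b s.
  by apply/ffunP => x; rewrite !ffunE; case: eqP.
rewrite /= /update !free_set_site !ss /= weight_set_true; last exact/negbTE.
by case: ifP => _ /=; rewrite ?s0 -/g; field.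
Qed.

Lemma heat_bath_cat ds1 ds2 f s :
  heat_bath (ds1 ++ ds2) f s = heat_bath ds1 (heat_bath ds2 f) s.
Proof. by elim: ds1 s => //= d ds1 IH s; rewrite !IH. Qed.

Lemma heat_bathZ ds c f s : heat_bath ds (fun s => c * f s) s = c * heat_bath ds f s.
Proof. by elim: ds s => //= d ds IH s; rewrite !IH; ring. Qed.

Lemma eq_heat_bath ds f g s : f =1 g -> heat_bath ds f s = heat_bath ds g s.
Proof. by move=> fg; elim: ds s => //= d ds IH s; rewrite !IH. Qed.

Definition osc_le f (c : R) := forall s s', `|f s - f s'| <= c.

Lemma normr_convex (a b c1 c2 : R) : `|a| <= c1 -> `|b| <= c2 ->
  `|q * a + p * b| <= q * c1 + p * c2.
Proof.
move=> h1 h2; apply: (le_trans (ler_normD _ _)).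
by rewrite (normrM q) (normrM p) (gtr0_norm q_gt0) (gtr0_norm p_gt0) lerD // ler_wpM2l // ltW.
Qed.

Lemma heat_bath_osc ds f c : osc_le f c -> osc_le (heat_bath ds f) c.
Proof.
move=> fc; elim: ds => //= d ds IH s s'.
have -> (a b a' b' : R) : lam / (1 + lam) * a + 1 / (1 + lam) * b
   - (lam / (1 + lam) * a' + 1 / (1 + lam) * b') = q * (a - a') + p * (b - b').
  by rewrite /p /q; ring.
have -> : c = q * c + p * c by rewrite -mulrDl pq1 mul1r.
exact: normr_convex.
Qed.

(* With probability at least [p ^+ size ds] all updates empty their site, and then the
   two initial configurations are forgotten. *)
Lemma heat_bath_coupling ds f c s s' : osc_le f c ->
  (forall x, x \notin ds -> s x = s' x) ->
  `|heat_bath ds f s - heat_bath ds f s'| <= (1 - p ^+ size ds) * c.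
Proof.
move=> fc; have c0 : 0 <= c by apply: le_trans (fc s s); exact: normr_ge0.
elim: ds s s' => [|d ds IH] s s' ss'.
  have -> : s = s' by apply/ffunP => x; apply: ss'.
  by rewrite /= !subrr normr0 mul0r.
rewrite /=.
have -> (a b a' b' : R) : lam / (1 + lam) * a + 1 / (1 + lam) * b
   - (lam / (1 + lam) * a' + 1 / (1 + lam) * b') = q * (a - a') + p * (b - b').
  by rewrite /p /q; ring.
(* Only the branch of probability [p], which empties [d], continues the coupling; the other is
   charged the full oscillation [c]. *)
have -> : (1 - p ^+ (size ds).+1) * c = q * c + p * ((1 - p ^+ size ds) * c).
  by rewrite exprS; have -> : q = 1 - p; [rewrite -pq1; ring | ring].
apply: normr_convex; first exact: heat_bath_osc.
apply: IH => x xds; rewrite !ffunE; case: eqP => // /eqP xd; apply: ss'.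
by rewrite inE negb_or xd.
Qed.

Lemma heat_bath_osc_iter ds n f c : (forall x, x \in ds) -> osc_le f c ->
  osc_le (heat_bath (flatten (nseq n ds)) f) ((1 - p ^+ size ds) ^+ n * c).
Proof.
move=> dsI; elim: n f c => [|n IHn] f c fc; first by rewrite expr0 mul1r.
move=> s s'; rewrite /= !heat_bath_cat exprS -mulrA.
by apply: heat_bath_coupling; [exact: IHn | move=> x; rewrite dsI].
Qed.

Lemma hc_sum1_gt0 : 0 < hc_sum (fun=> 1).
Proof.
have w0 s : 0 <= weight s.
  rewrite /weight; case: ifP => // _; apply: prodr_ge0 => x _.
  by case: ifP => // _; exact: ltW.
rewrite /hc_sum (bigD1 [ffun=> false]) //= mulr1 ltr_wpDr //.
  by apply: sumr_ge0 => s _; rewrite mulr1.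
rewrite /weight ifT; first by apply: prodr_gt0 => x _; case: ifP.
by apply/'forall_forallP => x y; rewrite !ffunE implybT.
Qed.

(** By invariance the updated function has the mean of [f], and a function of small oscillation is
    everywhere close to its mean. *)
Lemma heat_bath_mean ds n f c s : (forall x, x \in ds) -> osc_le f c ->
  `|heat_bath (flatten (nseq n ds)) f s - hc_sum f / hc_sum (fun=> 1)|
   <= (1 - p ^+ size ds) ^+ n * c.
Proof.
move=> dsI fc; have Z0 := hc_sum1_gt0; have Zn : hc_sum (fun=> 1) != 0 by rewrite gt_eqF.
rewrite -(heat_bath_invariant (flatten (nseq n ds)) f).
set g := heat_bath _ _.
have -> : g s - hc_sum g / hc_sum (fun=> 1) =
  (hc_sum (fun s' => g s - g s')) / hc_sum (fun=> 1).
  have -> : hc_sum (fun s' => g s - g s') = g s * hc_sum (fun=> 1) - hc_sum g.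
    rewrite /hc_sum mulr_sumr -sumrB; apply: eq_bigr => t _.
    by rewrite mulr1 mulrBr mulrC.
  by field.
rewrite normrM normfV (gtr0_norm Z0) ler_pdivrMr //.
rewrite /hc_sum mulr_sumr; apply: (le_trans (ler_norm_sum _ _ _)).
apply: ler_sum => t _; rewrite mulr1 normrM mulrC.
have w0 : 0 <= weight t.
  rewrite /weight; case: ifP => // _; apply: prodr_ge0 => x _.
  by case: ifP => // _; exact: ltW.
by rewrite (ger0_norm w0) ler_wpM2r //; apply: heat_bath_osc_iter.
Qed.

(** In finite volume the one-site Gibbs identity at [d] is invariance under the update at [d]: [f]
    and its update have the same hard-core mean, whence twice the error. *)
Lemma heat_bath_dlr ds n d f c s : (forall x, x \in ds) -> osc_le f c ->
  `|heat_bath (flatten (nseq n ds)) f s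
    - heat_bath (flatten (nseq n ds)) (heat_bath [:: d] f) s|
   <= 2 * ((1 - p ^+ size ds) ^+ n * c).
Proof.
move=> dsI fc.
have h1 := heat_bath_mean n s dsI fc.
have h2 := heat_bath_mean n s dsI (heat_bath_osc [:: d] fc).
rewrite heat_bath_invariant in h2.
rewrite mulr_natl mulr2n.
set m := (X in `|_ - X| <= _) in h1 h2.
rewrite (_ : heat_bath _ f s - _ = (heat_bath (flatten (nseq n ds)) f s - m) -
   (heat_bath (flatten (nseq n ds)) (heat_bath [:: d] f) s - m)); last by ring.
by apply: (le_trans (ler_normB _ _)); apply: lerD.
Qed.

End HeatBath.

(** * Random traps *)

(* Here [o] tells which vertices are open, and the site [i] of a pair [(i, u)] is
   updated with the randomness of the vertex [u]. *)
Fixpoint seq_update (V : choiceType) (I : finType) (e : rel I) (l : seq (I * V))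
    (o : V -> bool) (s : {ffun I -> bool}) : {ffun I -> bool} :=
  if l is iu :: l' then seq_update e l' o (update e iu.1 (o iu.2) s) else s.

Section RandomTraps.
Variables (R : realType) (V : choiceType) (d : measure_display)
  (Omega : measurableType d) (P : probability Omega R) (lam : R)
  (trap : Omega -> set V).
Hypothesis lam_gt0 : 0 < lam.
Hypothesis indep : independent_traps P (1 / (1 + lam)) trap.

Let p := 1 / (1 + lam).
Let q := lam / (1 + lam).

Let pq1 : q + p = 1.
Proof. by rewrite /p /q; field; rewrite gt_eqF // addr_gt0. Qed.

Definition is_open w v := `[< ~ trap w v >].

Definition pr (A : set Omega) : R := fine (P A).

Lemma prE A : measurable A -> P A = (pr A)%:E.
Proof. by move=> mA; rewrite fineK // fin_num_measure. Qed.

Lemma pr_split A B : measurable A -> measurable B -> pr A = pr (A `&` B) + pr (A `&` ~` B).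
Proof.
move=> mA mB; have mAB := measurableI _ _ mA mB.
have mAC : measurable (A `&` ~` B) by apply: measurableI => //; exact: measurableC.
apply: EFin_inj; rewrite EFinD -!prE // -measureU //.
  by rewrite -setIUr setUv setIT.
by apply/seteqP; split=> // x [[_ +] [_]].
Qed.

Lemma pr_le A B : measurable A -> measurable B -> A `<=` B -> pr A <= pr B.
Proof. by move=> mA mB AB; rewrite -lee_fin -!prE // le_measure ?inE. Qed.

Lemma measurable_is_open v : measurable [set w | is_open w v].
Proof.
have [mt _ _] := indep.
rewrite (_ : mkset _ = ~` [set w | trap w v]); first exact: measurableC.
by apply/seteqP; split=> w /= /asboolP.
Qed.

Definition pattern (l : seq (V * bool)) : set Omega :=
  [set w | forall vb, vb \in l -> is_open w vb.1 = vb.2].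

Lemma pattern_cons v b l :
  pattern ((v, b) :: l) = pattern l `&` [set w | is_open w v = b].
Proof.
apply/seteqP; split=> w /=.
  move=> h; split; last by apply: (h (v, b)); rewrite mem_head.
  by move=> vb vbl; apply: h; rewrite inE vbl orbT.
by move=> [h1 h2] vb; rewrite inE => /orP[/eqP ->|/h1].
Qed.

Lemma measurable_is_openb v b : measurable [set w | is_open w v = b].
Proof.
have mo := measurable_is_open v; case: b => //.
rewrite (_ : mkset _ = ~` [set w | is_open w v]); first exact: measurableC.
by apply/seteqP; split=> w /=; case: is_open.
Qed.

Lemma measurable_pattern l : measurable (pattern l).
Proof.
elim: l => [|[v b] l IHl].
  by rewrite (_ : pattern _ = setT) //; apply/seteqP; split.
by rewrite pattern_cons; apply: measurableI => //; exact: measurable_is_openb.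
Qed.

Let all_traps (A : {fset V}) : set Omega := [set w | forall v, v \in A -> trap w v].

Let measurable_all_traps A : measurable (all_traps A).
Proof.
have [mt _ _] := indep.
rewrite (_ : all_traps A = \bigcap_(v in [set` A]) [set w | trap w v]).
  by apply: fin_bigcap_measurable => //; exact: finite_fset.
by apply/seteqP; split=> w h v /=; [exact: h | exact: h].
Qed.

(** Independence is given for traps only. A prescribed trap is moved into [A], which is why [A] is
    general; a prescribed open vertex is handled by subtracting the case where it is a trap. *)
Let pattern_traps l (A : {fset V}) :
  uniq (map fst l) -> (forall v, v \in A -> v \notin map fst l) ->
  pr (pattern l `&` all_traps A) =
    (\prod_(vb <- l) (if vb.2 then q else p)) * p ^+ #|` A|.
Proof.
have [mt pt It] := indep.
elim: l A => [|[v b] l IHl] A.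
  move=> _ _; rewrite big_nil mul1r.
  rewrite (_ : pattern _ = setT) ?setTI; last by apply/seteqP; split.
  rewrite /pr It (eq_bigr (fun=> p%:E)); last by move=> v _; rewrite pt.
  rewrite prodEFin /=; rewrite big_const_seq count_predT.
  by elim: (size _) => /= [|n ->]; rewrite ?exprS.
move=> /= /andP[vl ul] dis.
have vA : v \notin A by apply/negP => /dis; rewrite inE eqxx.
have dis' u : u \in A -> u \notin map fst l.
  by move=> /dis; rewrite inE negb_or => /andP[].
have eT : pattern l `&` [set w | is_open w v = false] `&` all_traps A =
   pattern l `&` all_traps (v |` A)%fset.
  apply/seteqP; split=> w /=.
    move=> [[h1 h2] h3]; split=> // u; rewrite in_fset1U => /orP[/eqP ->|/h3 //].
    by apply: contrapT => /asboolP; rewrite -/(is_open w v) h2.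
  move=> [h1 h2]; split; last by move=> u uA; apply: h2; rewrite in_fset1U uA orbT.
  split=> //; apply/asboolP => /=; apply; apply: h2; by rewrite fset1U1.
have pT : pr (pattern l `&` [set w | is_open w v = false] `&` all_traps A) =
   (\prod_(vb <- l) (if vb.2 then q else p)) * p ^+ #|` A|.+1.
  rewrite eT IHl //; first by rewrite cardfsU1 vA.
  by move=> u; rewrite in_fset1U => /orP[/eqP ->|/dis'].
rewrite pattern_cons big_cons /=; case: b => /=; last by rewrite pT exprS; ring.
have mX : measurable (pattern l `&` all_traps A).
  by apply: measurableI => //; exact: measurable_pattern.
have := pr_split mX (measurable_is_open v).
have -> : pattern l `&` all_traps A `&` [set w | is_open w v] =
  pattern l `&` [set w | is_open w v = true] `&` all_traps A by rewrite setIAC.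
have -> : pattern l `&` all_traps A `&` ~` [set w | is_open w v] =
  pattern l `&` [set w | is_open w v = false] `&` all_traps A.
  by rewrite setIAC; congr (_ `&` _ `&` _); apply/seteqP; split=> w /=; case: is_open.
rewrite pT IHl // => h.
rewrite exprS in h; move: h; set a := pr _; set b := \prod_(_ <- _) _; set c := p ^+ _.
move=> h; rewrite (_ : q = 1 - p); last by rewrite -pq1; ring.
have -> : a = b * c - b * (p * c) by rewrite h addrK.
by ring.
Qed.

Lemma pr_pattern l : uniq (map fst l) ->
  pr (pattern l) = \prod_(vb <- l) (if vb.2 then q else p).
Proof.
move=> ul; have := @pattern_traps l fset0 ul.
rewrite cardfs0 expr0 mulr1 => <- //.
congr pr; apply/seteqP; split=> w /=; [by split | by case].
Qed.

Lemma measurable_seq_update (I : finType) (e : rel I) l (C : pred {ffun I -> bool}) s :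
  measurable [set w | C (seq_update e l (is_open w) s)].
Proof.
elim: l s => [|[i u] l IHl] s /=.
  case: (C s).
    by rewrite (_ : mkset _ = setT) //; apply/seteqP; split.
  by rewrite (_ : mkset _ = set0) //; apply/seteqP; split.
rewrite (_ : mkset _ =
  ([set w | is_open w u = true] `&` [set w | C (seq_update e l (is_open w) (update e i true s))])
  `|` ([set w | is_open w u = false] `&` [set w | C (seq_update e l (is_open w) (update e i false s))])).
  by apply: measurableU; apply: measurableI => //; exact: measurable_is_openb.
apply/seteqP; split=> w /=.
  by case: (is_open w u) => h; [left|right].
by case=> -[->].
Qed.

Lemma pr_seq_update (I : finType) (e : rel I) l (C : pred {ffun I -> bool}) s :
  uniq (map snd l) ->
  pr [set w | C (seq_update e l (is_open w) s)] =
    heat_bath e lam (map fst l) (fun s => (C s)%:R) s.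
Proof.
(* [l0] records the coins already revealed; its vertices differ from those of [l], so each update
   uses a fresh coin. *)
suff H l0 : uniq (map fst l0 ++ map snd l) ->
  pr (pattern l0 `&` [set w | C (seq_update e l (is_open w) s)]) =
  (\prod_(vb <- l0) (if vb.2 then q else p)) *
    heat_bath e lam (map fst l) (fun s => (C s)%:R) s.
  move=> ul; have := H [::] ul; rewrite big_nil mul1r => <-; congr pr.
  by apply/seteqP; split=> w //= [].
elim: l s l0 => [|[i u] l IHl] s l0 /=.
  rewrite cats0 => ul; case: (C s).
    by rewrite (_ : mkset _ = setT) ?setIT ?mulr1 ?pr_pattern //; apply/seteqP; split.
  rewrite (_ : mkset _ = set0) ?setI0 ?mulr0 /pr ?measure0 //.
  by apply/seteqP; split.
rewrite (perm_uniq (s2 := (u :: map fst l0) ++ map snd l)); last first.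
  by rewrite -cat1s perm_catCA.
move=> ul.
rewrite (pr_split (B := [set w | is_open w u])); last exact: measurable_is_open; last first.
  apply: measurableI; first exact: measurable_pattern.
  exact: (measurable_seq_update e ((i, u) :: l)).
have -> : pattern l0 `&` [set w | C (seq_update e l (is_open w) (update e i (is_open w u) s))]
   `&` [set w | is_open w u] = pattern ((u, true) :: l0) `&`
   [set w | C (seq_update e l (is_open w) (update e i true s))].
  rewrite pattern_cons; apply/seteqP; split=> w /=; first by move=> [[? h1] h2]; rewrite h2 in h1.
  by move=> [[? ->]].
have -> : pattern l0 `&` [set w | C (seq_update e l (is_open w) (update e i (is_open w u) s))]
   `&` ~` [set w | is_open w u] = pattern ((u, false) :: l0) `&`
   [set w | C (seq_update e l (is_open w) (update e i false s))].
  rewrite pattern_cons; apply/seteqP; split=> w /=.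
    by move=> [[? h1] /negP/negbTE h2]; rewrite h2 in h1.
  by move=> [[? ->]].
rewrite !IHl // !big_cons /= /p /q; ring.
Qed.

End RandomTraps.

(** * The layered graph *)

Lemma locally_finite_out (V : choiceType) (E : rel V) : locally_finite E ->
  forall x, exists s : seq V, forall y, (y \in s) = E x y.
Proof.
move=> lf x; have [/finite_seqP[s sE] _] := lf x; exists s => y.
have : (Out E x y) = [set` s] y by rewrite sE.
by rewrite /Out /= => h; apply/idP/idP; rewrite h.
Qed.

Lemma locally_finite_in (V : choiceType) (E : rel V) : locally_finite E ->
  forall x, exists s : seq V, forall y, (y \in s) = E y x.
Proof.
move=> lf x; have [_ /finite_seqP[s sE]] := lf x; exists s => y.
have : (In E x y) = [set` s] y by rewrite sE.
by rewrite /In /= => h; apply/idP/idP; rewrite h.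
Qed.

Lemma mem_filter_enum (I : finType) (a : pred I) x : (x \in [seq y <- enum I | a y]) = a x.
Proof. by rewrite mem_filter mem_enum andbT. Qed.

Arguments hv : simpl never.

Section Levels.
Variables (V : choiceType) (E : rel V) (S : int -> set V).
Hypotheses (S_part : is_partition S) (A1 : condA1 E S).

Lemma level_uniq i j x : S i x -> S j x -> i = j.
Proof. by case: S_part => tI _ Si Sj; apply: tI => //; exists x. Qed.

Definition lev (x : V) : int := xget 0 [set k | S k x].

Lemma levP x : S (lev x) x.
Proof.
case: S_part => _ uS; have : setT x by []; rewrite -uS => -[k _ Skx].
by rewrite /lev; case: xgetP => [y -> //|/(_ k)].
Qed.

Lemma levE k x : S k x <-> lev x = k.
Proof. by split=> [Sk|<-]; [exact: level_uniq (levP x) Sk | exact: levP]. Qed.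

Lemma lev_edge x y : E x y -> lev y = lev x + 1.
Proof. by move=> Exy; apply/levE; apply: (A1 (levP x)). Qed.

Definition lev_odd (x : V) : bool := odd `|lev x|%N.

Lemma lev_odd_alternating : alternating E lev_odd.
Proof.
by move=> x y /lev_edge; rewrite /lev_odd => ->; lia.
Qed.

Section Shift.
Variable phi : V -> V.
Hypotheses (phi_aut : automorphism E phi) (phiS : forall k, phi @` S k = S (k + 2))
  (phi_out : forall x, Out E x = In E (phi x)).

Lemma phi_inj : injective phi.
Proof. by case: phi_aut => /bij_inj. Qed.

Lemma phi_edge x y : E (phi x) (phi y) = E x y.
Proof. by case: phi_aut. Qed.

Lemma phi_rev x y : E x (phi y) = E y x.
Proof.
have : Out E y x = In E (phi y) x by rewrite phi_out.
by rewrite /Out /In /= => h; apply/idP/idP; rewrite h.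
Qed.

Lemma lev_phi x : lev (phi x) = lev x + 2.
Proof. by apply/levE; rewrite -phiS; exists x => //; exact: levP. Qed.

Lemma iter_phi_edge m x y : E (iter m phi x) (iter m phi y) = E x y.
Proof. by elim: m => //= m IHm; rewrite phi_edge. Qed.

Lemma lev_iter_phi m x : lev (iter m phi x) = lev x + (2 * m)%:Z.
Proof. by elim: m => /= [|m IHm]; rewrite ?lev_phi ?IHm; lia. Qed.

Lemma iter_phi_surj m y : exists x, y = iter m phi x.
Proof.
case: phi_aut => -[g gK Kg] _; elim: m y => [|m IHm] y; first by exists y.
by have [x gx] := IHm (g y); exists x; rewrite iterS -gx Kg.
Qed.

Variable k : int.

Definition site x := (lev x == k) || (lev x == k + 1).
Definition side x := lev x == k + 1.
Definition adj x y := [&& site x, site y & E x y || E y x].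

Lemma adj_sym : symmetric adj.
Proof. by move=> x y; rewrite /adj orbC andbCA. Qed.

Lemma adj_side x y : adj x y -> side y = ~~ side x.
Proof.
rewrite /adj /site /side => /and3P[sx sy /orP[/lev_edge|/lev_edge]]; lia.
Qed.

(** [D_k] spans two consecutive levels and [phi] climbs two, so the level of a vertex determines
    [m]. Distinct updates will thus read distinct vertices. *)
Lemma iter_phi_inj m m' x x' : site x -> site x' ->
  iter m phi x = iter m' phi x' -> m = m' /\ x = x'.
Proof.
move=> sx sx' h; have := congr1 lev h; rewrite !lev_iter_phi.
move=> hl; have mm' : m = m' by move: sx sx'; rewrite /site; lia.
split=> //; rewrite -{m' hl}mm' in h; elim: m h => //= m IHm /phi_inj; exact: IHm.
Qed.

Lemma site_iter_phi u : k <= lev u -> exists m x, site x /\ u = iter m phi x.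
Proof.
move=> ku; have [x ux] := iter_phi_surj (`|lev u - k|%N %/ 2)%N u.
exists (`|lev u - k|%N %/ 2)%N, x; split=> //.
by have := congr1 lev ux; rewrite lev_iter_phi /site; lia.
Qed.

(** From level [k] an edge stays within the [m]-th copy of [D_k]; from level [k + 1] it is, by
    [phi_rev], a reversed edge into the next copy. *)
Lemma out_iter_phi m x y : site x ->
  E (iter m phi x) y <-> exists x', adj x x' /\ y = iter (m + side x) phi x'.
Proof.
move=> sx; split.
  move=> Ey; case sdx : (side x).
    have [x' yx'] := iter_phi_surj m.+1 y; exists x'; rewrite addn1; split=> //.
    move: Ey; rewrite yx' iterSr iter_phi_edge phi_rev => Ex'.
    have := lev_edge Ex'; move: sdx sx; rewrite /adj /site /side Ex' orbT; lia.
  have [x' yx'] := iter_phi_surj m y; exists x'; rewrite addn0; split=> //.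
  move: Ey; rewrite yx' iter_phi_edge => Ex'.
  have := lev_edge Ex'; move: sdx sx; rewrite /adj /site /side Ex' /=; lia.
move=> [x' [/and3P[_ sx' Exx'] ->]]; case sdx : (side x).
  rewrite addn1 iterSr iter_phi_edge phi_rev; case/orP: Exx' => // /lev_edge.
  by move: sdx sx sx'; rewrite /site /side; lia.
rewrite addn0 iter_phi_edge; case/orP: Exx' => // /lev_edge.
by move: sdx sx sx'; rewrite /site /side; lia.
Qed.

(** * Finite volumes with extremal boundary condition *)

Section Volume.
Variable par : V -> bool.
Hypotheses (parE : alternating E par) (par_phi : forall x, par (phi x) = par x).

Lemma par_iter_phi m x : par (iter m phi x) = par x.
Proof. by elim: m => //= m IHm; rewrite par_phi. Qed.

Lemma par_adj x y : adj x y -> par y = ~~ par x.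
Proof. by move=> /and3P[_ _ /orP[/parE //|/parE ->]]; rewrite negbK. Qed.

(* Extremal boundary condition: outside the orbit of the volume [L], all vertices on the
   side where draws count as 0 become traps. *)
Definition boundary_traps (T : set V) (L : {fset V}) : set V :=
  T `|` [set u | par u = false /\ forall m x, x \in L -> u <> iter m phi x].

(** Closure under the neighbours of 0-side sites only: a site adjacent to [L] from outside is then
    on the 0-side, and the boundary condition makes its copies traps. *)
Definition closed_volume (L : {fset V}) :=
  (forall x, x \in L -> site x) /\
  (forall x y, x \in L -> par x = false -> adj x y -> y \in L).

(** Out-neighbours off the orbit of [L] are 0-side traps, of value 0 at every depth; they drop out,
    leaving the update rule with free boundary on [L]. *)
Lemma hv_volume (T : set V) (L : {fset V}) n m x : closed_volume L -> x \in L ->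
  hv E par (boundary_traps T L) n.+1 (iter m phi x) =
  `[< ~ T (iter m phi x) >] && [forall y : L, adj x (val y) ==>
     ~~ hv E par (boundary_traps T L) n (iter (m + side x) phi (val y))].
Proof.
move=> [L1 L2] xL; set T' := boundary_traps T L; have sx := L1 x xL.
have TT' : T' (iter m phi x) <-> T (iter m phi x).
  by split=> [[//|[_ /(_ m x xL)]//]|]; left.
apply/hvP/andP.
  move=> [nT h]; split; first by apply/asboolP => /TT'.
  apply/forallP => y; apply/implyP => axy; apply/negPf; apply: h.
  by apply/(out_iter_phi m _ sx); exists (val y).
move=> [/asboolP nT /forallP h]; split; first by move=> /TT'.
move=> _ /(out_iter_phi m _ sx) [y [axy ->]].
have [yL|yL] := boolP (y \in L).
  by have := h [` yL]%fset; rewrite axy /= => /negPf.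
have py : par y = false.
  apply/negP => py; move/negP: yL; apply; apply: (L2 x) => //.
  by have := par_adj axy; rewrite py => /esym/negbTE.
apply: hv_trap; last by rewrite par_iter_phi.
right; split; first by rewrite par_iter_phi.
move=> m' x' x'L /iter_phi_inj [||_ yx'].
- by case/and3P: axy.
- exact: L1.
- by rewrite yx' x'L in yL.
Qed.


Hypothesis outs : forall x, exists s : seq V, forall y, (y \in s) = E x y.
Hypothesis ins : forall x, exists s : seq V, forall y, (y \in s) = E y x.

(** The level bound matters because only vertices at level [k] or above are images of sites under
    iterates of [phi]. *)
Lemma hv_local N x : exists s : seq V,
  (forall u, u \in s -> lev x <= lev u) /\
  forall T T', (forall u, u \in s -> T' u <-> T u) ->
   hv E par T' N x = hv E par T N x.
Proof.
elim: N x => [|N IHN] x; first by exists [::].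
have [g hg] := choice IHN; have [t tE] := outs x.
exists (x :: flatten (map g t)); split.
  move=> u; rewrite inE => /orP[/eqP -> //|/flattenP[_ /mapP[y yt ->] uy]].
  have [h _] := hg y; have := h u uy; move: yt; rewrite tE => /lev_edge ->; lia.
move=> T T' TT'; have TTx : T' x <-> T x by apply: TT'; rewrite mem_head.
have eqy y : E x y -> hv E par T' N y = hv E par T N y.
  move=> Exy; have [_] := hg y; apply=> u uy; apply: TT'; rewrite inE; apply/orP; right.
  by apply/flattenP; exists (g y) => //; apply: map_f; rewrite tE.
apply/hvP/hvP => -[Tx h]; split.
- by move=> /TTx.
- by move=> y Exy; rewrite -eqy //; apply: h.
- by move=> /TTx.
- by move=> y Exy; rewrite eqy //; apply: h.
Qed.

Lemma adj_finite x : exists s : seq V, forall y, (y \in s) = adj x y.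
Proof.
have [so soE] := outs x; have [si siE] := ins x.
exists [seq y <- so ++ si | site x && site y] => y.
by rewrite mem_filter mem_cat soE siE /adj andbA.
Qed.

(** [L] is chosen before [T], so one volume serves all trap configurations, and [n] is unbounded,
    which leaves room for relaxation. *)
Lemma exhausting_volume (G : seq V) (N : nat) : (forall x, x \in G -> site x) ->
  exists L : {fset V}, [/\ closed_volume L, forall x, x \in G -> x \in L &
    forall T x n, x \in G -> hv E par T N x = hvlim E par T x -> (N <= n)%N ->
      hv E par (boundary_traps T L) n x = hvlim E par T x].
Proof.
move=> Gs; have [b hb] := choice (hv_local N).
have /choice[pj hpj] u : exists z, k <= lev u ->
    site z /\ exists m, u = iter m phi z.
  case: (leP k (lev u)) => [/site_iter_phi[m [x [sx ux]]]|_]; last by exists u.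
  by exists x => _; split=> //; exists m.
have [nb hnb] := choice adj_finite.
pose U := G ++ flatten (map b G).
have Ulev u : u \in U -> k <= lev u.
  have Gl x : x \in G -> k <= lev x by move=> /Gs; rewrite /site; lia.
  rewrite mem_cat => /orP[/Gl //|/flattenP[_ /mapP[x xG ->] ux]].
  by have [h _] := hb x; apply: le_trans (Gl x xG) (h u ux).
(* [D] contains the base site of every vertex inspected at depth [N], so the boundary traps miss all
   of these vertices. *)
pose D := G ++ map pj U.
have Ds x : x \in D -> site x.
  rewrite mem_cat => /orP[/Gs //|/mapP[u uU ->]].
  by have [] := hpj u (Ulev u uU).
(* One round of closure is enough: the neighbours added to 0-side sites lie on the 1-side. *)
pose L := [fset x in D ++ flatten [seq nb x | x <- D & ~~ par x]]%fset.
have inL x : (x \in L) = (x \in D) || (x \in flatten [seq nb x | x <- D & ~~ par x]).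
  by rewrite !inE mem_cat.
have Lnb x : x \in flatten [seq nb x | x <- D & ~~ par x] ->
    exists y, [/\ y \in D, par y = false & adj y x].
  move=> /flattenP[_ /mapP[y + ->]]; rewrite mem_filter hnb => /andP[/negbTE py yD] ayx.
  by exists y.
have DL x : x \in D -> x \in L by move=> xD; rewrite inL xD.
exists L; split.
- split=> [x|x y]; rewrite inL => /orP[xD|/Lnb[z [zD pz azx]]].
  + exact: Ds.
  + by case/and3P: azx.
  + move=> px axy; rewrite inL; apply/orP; right.
    apply/flattenP; exists (nb x); last by rewrite hnb.
    by apply: map_f; rewrite mem_filter px.
  + by rewrite (par_adj azx) pz.
- by move=> x xG; apply: DL; rewrite mem_cat xG.
- move=> T x n xG hN Nn.
  apply: (hv_sandwich (N := N) parE) => //.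
  + by move=> u Tu; left.
  + by move=> u [//|[-> ]].
  + have [_ ] := hb x; apply=> u ub; split; last by left.
    case=> // -[pu nu]; exfalso.
    have uU : u \in U.
      rewrite mem_cat; apply/orP; right; apply/flattenP; exists (b x) => //.
      exact: map_f.
    have [_ [m um]] := hpj u (Ulev u uU).
    apply: (nu m (pj u)) => //; apply: DL; rewrite mem_cat; apply/orP; right.
    exact: map_f.
Qed.

(** * Game values as heat-bath sweeps *)

Section Process.
Variables (L : {fset V}) (T : set V).
Hypothesis L_closed : closed_volume L.
Let e : rel L := fun x y => adj (val x) (val y).
Let o v := `[< ~ T v >].

(** Level [k + 1] goes first: within a sweep, level [k] reads the values just computed there. *)
Definition volume_sites : seq L :=
  [seq x <- enum {: L} | side (val x)] ++ [seq x <- enum {: L} | ~~ side (val x)].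

Definition sweep m : seq (L * V) := [seq (x, iter m phi (val x)) | x <- volume_sites].

(* The sweeps at the times [m + n - 1], ..., [m], in this order. *)
Fixpoint sweeps m n : seq (L * V) :=
  if n is n'.+1 then sweeps m.+1 n' ++ sweep m else [::].

Lemma mem_volume_sites x : x \in volume_sites.
Proof. by rewrite mem_cat !mem_filter_enum orbN. Qed.

Lemma sweeps_sites m n : map fst (sweeps m n) = flatten (nseq n volume_sites).
Proof.
elim: n m => //= n IHn m; rewrite map_cat IHn -map_comp map_id.
by elim: n {IHn} => /= [|n IHn]; rewrite ?cats0 // -catA IHn.
Qed.

Lemma sweeps_vertices m n u : u \in map snd (sweeps m n) ->
  exists m' x, [/\ (m <= m')%N, x \in L & u = iter m' phi x].
Proof.
elim: n m => //= n IHn m; rewrite map_cat mem_cat => /orP[/IHn|].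
  by move=> [m' [x [mm' xL ->]]]; exists m', x; split=> //; lia.
by rewrite -map_comp => /mapP[x _ ->]; exists m, (val x); split=> //; exact: valP.
Qed.

Lemma sweeps_uniq m n : uniq (map snd (sweeps m n)).
Proof.
have [L1 _] := L_closed.
elim: n m => //= n IHn m; rewrite map_cat cat_uniq IHn -map_comp /=; apply/andP; split.
  apply/hasPn => _ /mapP[x _ ->] /=; apply/negP => /sweeps_vertices[m' [x' [mm' x'L h]]].
  have [] := iter_phi_inj (L1 _ (valP x)) (L1 _ x'L) h; lia.
rewrite map_inj_in_uniq.
  rewrite cat_uniq 2?(filter_uniq _ (enum_uniq _)) andbT /=.
  by apply/hasPn => x; rewrite !mem_filter_enum => /negbTE ->.
move=> x y _ _ /= /(iter_phi_inj (L1 _ (valP x)) (L1 _ (valP y)))[_].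
exact: val_inj.
Qed.

Lemma seq_update_cat (I : finType) (r : rel I) (l1 l2 : seq (I * V)) (op : V -> bool) s :
  seq_update r (l1 ++ l2) op s = seq_update r l2 op (seq_update r l1 op s).
Proof. by elim: l1 s => //= a l1 IH s. Qed.

Lemma seq_update_independent (I : finType) (r : rel I) (ds : seq I) (h : I -> V)
    (op : V -> bool) s :
  (forall x y, x \in ds -> y \in ds -> ~~ r x y) ->
  seq_update r [seq (x, h x) | x <- ds] op s =
  [ffun x => if x \in ds then op (h x) && free r x s else s x].
Proof.
elim: ds s => [|x ds IH] s indep /=; first by apply/ffunP => y; rewrite ffunE.
rewrite IH; last by move=> y z yd zd; apply: indep; rewrite inE ?yd ?zd orbT.
apply/ffunP => y; rewrite !ffunE inE; case yds : (y \in ds).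
  rewrite orbT; congr andb; apply: eq_forallb => z; rewrite !ffunE; case: eqP => // ->.
  by rewrite (negbTE (indep y x _ _)) ?inE ?yds ?eqxx ?orbT.
by rewrite orbF; case: eqP => // ->.
Qed.

(** Each sweep adds two to the depth, and level [k + 1] lags by one, since it reads level [k] as
    left by the preceding sweep. For [n = 0] the truncated subtraction gives depth 0 on both levels,
    the initial configuration. *)
Lemma sweeps_hv m n :
  seq_update e (sweeps m n) o [ffun x : L => par (val x)] =
  [ffun x : L => hv E par (boundary_traps T L) (n.*2 - side (val x)) (iter m phi (val x))].
Proof.
elim: n m => [|n IHn] m /=.
  by apply/ffunP => x; rewrite !ffunE double0 sub0n /hv par_iter_phi.
rewrite seq_update_cat IHn /sweep map_cat seq_update_cat.
have eside x y : e x y -> side (val y) = ~~ side (val x) by exact: adj_side.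
rewrite !seq_update_independent; last 2 first.
- move=> x y; rewrite !mem_filter_enum => sx sy.
  by apply/negP => /eside; rewrite sx sy.
- move=> x y; rewrite !mem_filter_enum => sx sy.
  by apply/negP => /eside; rewrite (negbTE sx) (negbTE sy).
have odd_step x : side (val x) ->
  o (iter m phi (val x)) && free e x [ffun x : L =>
     hv E par (boundary_traps T L) (n.*2 - side (val x)) (iter m.+1 phi (val x))] =
  hv E par (boundary_traps T L) n.*2.+1 (iter m phi (val x)).
  move=> sx; rewrite hv_volume ?fsvalP // sx addn1; congr andb.
  apply: eq_forallb => y; rewrite ffunE /e; case axy : (adj _ _) => //=.
  by have := adj_side axy; rewrite sx => -> /=; rewrite subn0.
apply/ffunP => x; rewrite !ffunE !mem_filter_enum.
case sx : (side (val x)) => /=.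
  by rewrite odd_step // doubleS subn1.
rewrite subn0 doubleS hv_volume ?fsvalP // sx addn0; congr andb.
apply: eq_forallb => y; rewrite !ffunE mem_filter_enum /e.
case axy : (adj _ _) => //=; have := adj_side axy; rewrite sx => sy.
by rewrite sy odd_step.
Qed.

End Process.
End Volume.
End Shift.
End Levels.

(** * Isomorphisms between the graphs [D_k] *)

Lemma isomorphic_refl (V : choiceType) (E : rel V) : isomorphic E E.
Proof. by exists id; split=> //; exists id. Qed.

Lemma isomorphic_sym (V W : choiceType) (E : rel V) (F : rel W) :
  isomorphic E F -> isomorphic F E.
Proof.
move=> [f [[g fK gK] fE]]; exists g; split; first by exists f.
by move=> x y; rewrite -fE !gK.
Qed.

Lemma isomorphic_trans (U V W : choiceType) (D : rel U) (E : rel V) (F : rel W) :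
  isomorphic D E -> isomorphic E F -> isomorphic D F.
Proof.
move=> [f [fb fE]] [g [gb gE]]; exists (g \o f); split; first exact: bij_comp.
by move=> x y /=; rewrite gE fE.
Qed.

Section DoublingLayers.
Variables (V : choiceType) (E : rel V) (S : int -> set V).
Hypotheses (S_part : is_partition S) (A1 : condA1 E S) (A2 : condA2 E S).

Lemma in_Dvertex k x : (x \in S k `|` S (k + 1)) = site S k x.
Proof.
rewrite /site; apply/idP/idP.
  rewrite inE => -[/(levE S_part) ->|/(levE S_part) ->]; by rewrite eqxx ?orbT.
by move=> /orP[/eqP/(levE S_part)|/eqP/(levE S_part)] h; rewrite inE; [left|right].
Qed.

(** Level [k + 1] is kept and level [k] is moved by [phi] to level [k + 2]; edges between them are
    reversed, which undirected adjacency does not see. *)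
Lemma Dadj_succ k : isomorphic (@Dadj V E S k) (@Dadj V E S (k + 1)).
Proof.
have [phi [phi_aut phiS phi_out]] := A2.
have lphi := lev_phi S_part phiS.
pose h x := if lev S x == k then phi x else x.
have hsite x : site S k x -> site S (k + 1) (h x).
  by rewrite /site /h; case: eqP => [e|_]; rewrite ?lphi; lia.
have /choice[f fE] (x : Dvertex S k) : exists y : Dvertex S (k + 1), val y = h (val x).
  have hx : h (val x) \in S (k + 1) `|` S (k + 1 + 1).
    by rewrite in_Dvertex; apply: hsite; rewrite -in_Dvertex; exact: valP.
  by exists (exist _ (h (val x)) hx).
have f_inj : injective f.
  move=> x y /(congr1 val); rewrite !fE => hxy; apply: val_inj; move: hxy.
  have sx : site S k (val x) by rewrite -in_Dvertex; exact: valP.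
  have sy : site S k (val y) by rewrite -in_Dvertex; exact: valP.
  rewrite /h; case: eqP => ex; case: eqP => ey //.
  - exact: (phi_inj phi_aut).
  - by move=> /(congr1 (lev S)); move: sx sy; rewrite lphi /site; lia.
  - by move=> /(congr1 (lev S)); move: sx sy; rewrite lphi /site; lia.
have f_surj y : exists x, f x = y.
  have sy : site S (k + 1) (val y) by rewrite -in_Dvertex; exact: valP.
  have [x [sx hx]] : exists x, site S k x /\ h x = val y.
    have [ly|ly] := eqVneq (lev S (val y)) (k + 1).
      exists (val y); split; first by rewrite /site ly eqxx orbT.
      by rewrite /h; case: eqP => //; rewrite ly; lia.
    have [x yx] := iter_phi_surj phi_aut 1 (val y).
    have := congr1 (lev S) yx; rewrite (lev_iter_phi S_part phiS) => lx.
    have ex : lev S x = k by move: sy ly; rewrite /site; lia.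
    by exists x; rewrite /site /h ex eqxx.
  have hx' : x \in S k `|` S (k + 1) by rewrite in_Dvertex.
  by exists (exist _ x hx'); apply: val_inj; rewrite fE.
have /choice[g gK] := f_surj.
exists f; split; first by exists g => // x; apply: f_inj; rewrite gK.
have hE x y : site S k x -> site S k y -> lev S x = k -> lev S y = k + 1 ->
    E (h x) (h y) || E (h y) (h x) = E x y || E y x.
  move=> sx sy lx ly; rewrite /h lx eqxx ly ifF; last lia.
  rewrite (phi_rev phi_out); case: (E x y); rewrite ?orbT //=.
  rewrite orbF; apply/idP/idP => /(lev_edge S_part A1); rewrite ?lphi; lia.
have hEE x y : site S k x -> site S k y -> lev S x = lev S y ->
    E (h x) (h y) || E (h y) (h x) = E x y || E y x.
  move=> sx sy lxy; rewrite /h lxy.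
  have -> : E x y || E y x = false.
    by apply/orP => -[|] /(lev_edge S_part A1); rewrite lxy; lia.
  by apply/orP => -[|] /(lev_edge S_part A1); case: eqP; rewrite ?lphi ?lxy; lia.
move=> x y; rewrite /Dadj !fE.
have sx : site S k (val x) by rewrite -in_Dvertex; exact: valP.
have sy : site S k (val y) by rewrite -in_Dvertex; exact: valP.
have [lxy|lxy] := eqVneq (lev S (val x)) (lev S (val y)); first exact: hEE.
case/orP: (sx) => /eqP lx; case/orP: (sy) => /eqP ly.
- by rewrite lx ly eqxx in lxy.
- exact: hE.
- by rewrite orbC [RHS]orbC; exact: hE.
- by rewrite lx ly eqxx in lxy.
Qed.

Lemma Dadj_isomorphic k l : isomorphic (@Dadj V E S k) (@Dadj V E S l).
Proof.
wlog kl : k l / k <= l.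
  move=> H; have [/H //|/ltW/H] := leP k l; exact: isomorphic_sym.
have -> : l = k + `|l - k|%N%:Z by lia.
elim: `|l - k|%N => [|n IHn]; first by rewrite addr0; exact: isomorphic_refl.
apply: isomorphic_trans IHn _.
have -> : k + n.+1%:Z = k + n%:Z + 1 by lia.
exact: Dadj_succ.
Qed.

End DoublingLayers.

(** * Passage to the limit *)

Section Measurability.
Variables (R : realType) (V : choiceType) (E : rel V) (d : measure_display)
  (Omega : measurableType d) (P : probability Omega R) (p : R)
  (trap : Omega -> set V) (par : V -> bool).
Hypothesis indep : independent_traps P p trap.
Hypothesis outs : forall x, exists s : seq V, forall y, (y \in s) = E x y.

Lemma measurable_all_in (T : eqType) (s : seq T) (B : T -> set Omega) :
  (forall y, measurable (B y)) -> measurable [set w | forall y, y \in s -> B y w].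
Proof.
move=> mB; elim: s => [|y s IHs].
  by rewrite (_ : mkset _ = setT) //; apply/seteqP; split.
rewrite (_ : mkset _ = B y `&` [set w | forall y, y \in s -> B y w]).
  exact: measurableI.
apply/seteqP; split=> w /=.
  by move=> h; split; [apply: h; rewrite mem_head | move=> z zs; apply: h; rewrite inE zs orbT].
by move=> [h1 h2] z; rewrite inE => /orP[/eqP ->|/h2].
Qed.

Lemma measurableNb (B : Omega -> bool) : measurable [set w | B w] ->
  measurable [set w | B w = false].
Proof.
move=> mB; rewrite (_ : mkset _ = ~` [set w | B w]); first exact: measurableC.
by apply/seteqP; split=> w /=; case: (B w).
Qed.

Lemma measurable_hv n x : measurable [set w | hv E par (trap w) n x].
Proof.
have [mt _ _] := indep.
elim: n x => [|n IHn] x.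
  rewrite /hv; case: (par x).
    by rewrite (_ : mkset _ = setT) //; apply/seteqP; split.
  by rewrite (_ : mkset _ = set0) //; apply/seteqP; split.
have [s sE] := outs x.
rewrite (_ : mkset _ = ~` [set w | trap w x] `&`
    [set w | forall y, y \in s -> [set w | hv E par (trap w) n y = false] w]).
  apply: measurableI; first exact: measurableC.
  by apply: measurable_all_in => y; exact: measurableNb.
apply/seteqP; split=> w /=.
  by move=> /hvP[Tx h]; split=> // y; rewrite sE; exact: h.
by move=> [Tx h]; apply/hvP; split=> // y; rewrite -sE; exact: h.
Qed.

Lemma measurable_hvlim x : measurable [set w | hvlim E par (trap w) x].
Proof.
rewrite /hvlim; case: (par x).
  rewrite (_ : mkset _ = \bigcap_n [set w | hv E par (trap w) n x]).
    by apply: bigcapT_measurable => n; exact: measurable_hv.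
  by apply/seteqP; split=> w /= => [/asboolP h n _|h]; [exact: h | apply/asboolP => n; exact: h].
rewrite (_ : mkset _ = \bigcup_n [set w | hv E par (trap w) n x]).
  by apply: bigcup_measurable => n _; exact: measurable_hv.
by apply/seteqP; split=> w /= => [/asboolP[n h]|[n _ h]]; [exists n | apply/asboolP; exists n].
Qed.

Lemma pr_diff_le (A B C : set Omega) : measurable A -> measurable B -> measurable C ->
  A `&` ~` C = B `&` ~` C -> `|pr P A - pr P B| <= pr P C.
Proof.
move=> mA mB mC AB.
rewrite (pr_split P mA mC) (pr_split P mB mC) AB.
have le0 D : 0 <= pr P D by apply: fine_ge0; exact: measure_ge0.
have hA : pr P (A `&` C) <= pr P C by apply: pr_le => //; exact: measurableI.
have hB : pr P (B `&` C) <= pr P C by apply: pr_le => //; exact: measurableI.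
have hA0 := le0 (A `&` C); have hB0 := le0 (B `&` C).
by rewrite ler_norml; apply/andP; split; lra.
Qed.

Hypothesis parE : alternating E par.

(** A value that has reached its limit stays there, so the bad events decrease; since [G] is finite
    their intersection is empty, and continuity from above applies. *)
Lemma hv_cvg_uniform (G : seq V) (eps : R) : 0 < eps ->
  exists N, measurable [set w | exists2 x, x \in G & hv E par (trap w) N x != hvlim E par (trap w) x]
   /\ pr P [set w | exists2 x, x \in G & hv E par (trap w) N x != hvlim E par (trap w) x] < eps.
Proof.
move=> eps0.
pose bad N := [set w | exists2 x, x \in G & hv E par (trap w) N x != hvlim E par (trap w) x].
have mbad N : measurable (bad N).
  rewrite (_ : bad N = ~` [set w | forall x, x \in G ->
      [set w | hv E par (trap w) N x = hvlim E par (trap w) x] w]).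
    apply/measurableC/measurable_all_in => x.
    have m1 := measurable_hv N x; have m2 := measurable_hvlim x.
    rewrite (_ : mkset _ =
      ([set w | hv E par (trap w) N x] `&` [set w | hvlim E par (trap w) x]) `|`
      ([set w | hv E par (trap w) N x = false] `&` [set w | hvlim E par (trap w) x = false])).
      by apply: measurableU; apply: measurableI => //; exact: measurableNb.
    apply/seteqP; split=> w /=.
      by move=> ->; case: (hvlim _ _ _ _); [left|right].
    by case=> -[]; [move=> -> -> | move=> -> ->].
  apply/seteqP; split=> w /=.
    by move=> [x xG /eqP nx] h; apply: nx; exact: h.
  by move=> h; apply: contrapT => h'; apply: h => x xG; apply: contrapT => /eqP nx; apply: h'; exists x.
have capb : \bigcap_N bad N = set0.
  apply/seteqP; split=> // w /= h.
  suff [N hN] : exists N, forall x, x \in G -> hv E par (trap w) N x = hvlim E par (trap w) x.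
    by have [x xG /eqP] := h N I; apply; exact: hN.
  elim: (G) => [|x s [N hN]]; first by exists 0%N.
  have [n hn] := hvlim_cvg E par (trap w) x.
  have up k m y : (m <= k)%N -> hv E par (trap w) m y = hvlim E par (trap w) y ->
      hv E par (trap w) k y = hvlim E par (trap w) y.
    by move=> mk hm; apply: (hv_sandwich (N := m) parE).
  exists (maxn n N) => y; rewrite inE => /orP[/eqP ->|ys].
    by apply: up hn; exact: leq_maxl.
  by apply: up (hN y ys); exact: leq_maxr.
have cv : (P \o bad) N @[N --> \oo] --> P (\bigcap_N bad N).
  apply: nonincreasing_cvg_mu => //.
  - by rewrite (le_lt_trans (probability_le1 _ _)) // ltry.
  - by rewrite capb.
  - apply/nonincreasing_seqP => n; apply/subsetPset => w [x xG nx]; exists x => //.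
    by apply: contra nx => /eqP/(hvlim_step parE) ->.
rewrite capb measure0 in cv.
have /fine_cvgP[_ /cvgrPdist_lt/(_ _ eps0)[N _ hN]] := cv.
exists N; split; first exact: mbad.
have := hN N (leqnn N); rewrite /= sub0r normrN; apply: le_lt_trans.
exact: ler_norm.
Qed.

End Measurability.

(** * The one-site Gibbs identity for cylinder events *)

Section Cylinders.
Variables (R : realType) (V : choiceType) (E : rel V) (S : int -> set V).
Hypotheses (E_locfin : locally_finite E) (S_part : is_partition S) (A1 : condA1 E S).
Variable phi : V -> V.
Hypotheses (phi_aut : automorphism E phi) (phiS : forall k, phi @` S k = S (k + 2))
  (phi_out : forall x, Out E x = In E (phi x)).
Variables (k : int) (par : V -> bool).
Hypotheses (parE : alternating E par) (par_phi : forall x, par (phi x) = par x).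
Variables (d : measure_display) (Omega : measurableType d) (P : probability Omega R)
  (lam : R) (trap : Omega -> set V).
Hypothesis lam_gt0 : 0 < lam.
Hypothesis indep : independent_traps P (1 / (1 + lam)) trap.

Let eta w x := hvlim E par (trap w) x.
Let outs := locally_finite_out E_locfin.
Let ins := locally_finite_in E_locfin.

Lemma measurable_occupied (F : seq V) : measurable [set w | forall x, x \in F -> eta w x].
Proof.
apply: (@measurable_all_in _ _ _ F (fun x => [set w | eta w x])) => x.
exact: measurable_hvlim indep outs x.
Qed.

Lemma measurable_vacant (v : V) :
  measurable [set w | forall y, adj E S k v y -> eta w y = false].
Proof.
have [s sE] := adj_finite S k outs ins v.
rewrite (_ : mkset _ = [set w | forall y, y \in s -> [set w | eta w y = false] w]).
  apply: measurable_all_in => y; apply: measurableNb; exact: measurable_hvlim indep outs y.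
by apply/seteqP; split=> w h y; have := h y; rewrite sE.
Qed.

Lemma geometric_small (r : nat) (eps : R) : 0 < eps ->
  exists n0, forall n, (n0 <= n)%N -> (1 - (1 / (1 + lam)) ^+ r) ^+ n < eps.
Proof.
move=> eps0; set p := 1 / (1 + lam).
have p0 : 0 < p by rewrite divr_gt0 // addr_gt0.
have p1 : p <= 1 by rewrite ler_pdivrMr ?addr_gt0 // mul1r lerDl ltW.
have pr0 : 0 < p ^+ r by rewrite exprn_gt0.
have pr1 : p ^+ r <= 1 by rewrite exprn_ile1 // ltW.
have lt1 : `|1 - p ^+ r| < 1 by rewrite ger0_norm; lra.
have /cvgrPdist_lt/(_ _ eps0)[n0 _ hn] := cvg_expr lt1.
exists n0 => n n0n; have := hn n n0n; rewrite /= sub0r normrN; apply: le_lt_trans.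
exact: ler_norm.
Qed.

(* The finite-volume processes started from the extremal configuration decrease (for the
   order reversed on one side) to the limit, and they relax to the finite-volume
   hard-core measure, for which the identity is exact. *)
Lemma cylinder_dlr (v : V) (F : seq V) : site S k v -> (forall x, x \in F -> site S k x) ->
  v \notin F ->
  pr P [set w | forall x, x \in v :: F -> eta w x] =
  lam / (1 + lam) * pr P ([set w | forall x, x \in F -> eta w x] `&`
     [set w | forall y, adj E S k v y -> eta w y = false]).
Proof.
move=> sv sF vF; set A := [set w | _]; set B := _ `&` _.
have mA : measurable A by exact: measurable_occupied.
have mB : measurable B.
  by apply: measurableI; [exact: measurable_occupied | exact: measurable_vacant].
have l1 : 0 < 1 + lam by rewrite addr_gt0.
have q0 : 0 <= lam / (1 + lam) by rewrite divr_ge0 // ltW.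
have q1 : lam / (1 + lam) <= 1 by rewrite ler_pdivrMr // mul1r lerDr.
(* The 4 counts two errors [pr P bad], from replacing the limit by the finite volume, and twice the
   relaxation error. *)
suff H eps : 0 < eps -> `|pr P A - lam / (1 + lam) * pr P B| <= 4 * eps.
  apply/eqP; rewrite -subr_eq0 -normr_le0; apply/ler_addgt0Pl => eps eps0.
  by rewrite addr0; have := H (eps / 4); rewrite divr_gt0 // => /(_ isT); lra.
move=> eps0.
have [s sE] := adj_finite S k outs ins v.
pose G := v :: F ++ s.
have [N [mbad hbad]] := hv_cvg_uniform indep outs parE G eps0.
set bad := [set w | _] in mbad hbad.
have sG x : x \in G -> site S k x.
  rewrite inE mem_cat => /orP[/eqP -> //|/orP[/sF //|]].
  by rewrite sE => /and3P[].
have [L [Lc GL Lhv]] := exhausting_volume S_part A1 phi_aut phiS parE outs ins N sG.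
have [n0 hn0] := geometric_small (size (volume_sites S k L)) eps0.
(* The volume [L] is fixed by now, so [n] may depend on its size through [n0]; both depths [n.*2]
   and [n.*2 - 1] are at least [N]. *)
pose n := (N + n0 + 1)%N.
pose e : rel L := fun x y => adj E S k (val x) (val y).
pose init : {ffun L -> bool} := [ffun x => par (val x)].
pose z w := seq_update e (sweeps S phi k L 0 n) (is_open trap w) init.
have zE w x : z w x = hv E par (boundary_traps phi par (trap w) L) (n.*2 - side S k (val x)) (val x).
  by rewrite /z (sweeps_hv S_part A1 phi_aut phiS phi_out parE par_phi (trap w) Lc 0 n) ffunE.
have zeta w (x : L) : ~ bad w -> val x \in G -> z w x = eta w (val x).
  move=> nb xG; rewrite zE; apply: Lhv => //.
    by apply: contrapT => /eqP nx; apply: nb; exists (val x).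
  by rewrite /n; case: side; lia.
have vL : v \in L by apply: GL; rewrite mem_head.
pose v' : L := [` vL]%fset.
pose CF (c : {ffun L -> bool}) := [forall x : L, (val x \in F) ==> c x].
pose C1 (c : {ffun L -> bool}) := c v' && CF c.
pose C2 (c : {ffun L -> bool}) := free e v' c && CF c.
pose hb f := heat_bath e lam (flatten (nseq n (volume_sites S k L))) f init.
have uz := sweeps_uniq S_part phi_aut phiS Lc 0 n.
have przE (C : pred {ffun L -> bool}) : pr P [set w | C (z w)] = hb (fun c => (C c)%:R).
  by rewrite /hb -(sweeps_sites S phi k L 0 n) -(pr_seq_update lam_gt0 indep).
have mz (C : pred {ffun L -> bool}) : measurable [set w | C (z w)].
  exact: (measurable_seq_update indep).
have CFw w : ~ bad w -> CF (z w) <-> (forall x, x \in F -> eta w x).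
  move=> nb; split.
    move=> /forallP h x xF.
    have xG : x \in G by rewrite inE mem_cat xF orbT.
    have := h [` GL _ xG]%fset; rewrite /= xF /=.
    by rewrite (zeta w [` GL _ xG]%fset).
  move=> h; apply/forallP => x; apply/implyP => xF; rewrite zeta //; first exact: h.
  by rewrite inE mem_cat xF orbT.
have d1 : `|pr P [set w | C1 (z w)] - pr P A| <= pr P bad.
  apply: pr_diff_le => //; apply/seteqP; split=> w /= [h nb]; split=> //.
    case/andP: h => zv /(CFw w nb) h x; rewrite inE => /orP[/eqP ->|/h //].
    by move: zv; rewrite zeta // mem_head.
  apply/andP; split; first by rewrite zeta ?mem_head //; apply: h; rewrite mem_head.
  by apply/(CFw w nb) => x xF; apply: h; rewrite inE xF orbT.
have d2 : `|pr P [set w | C2 (z w)] - pr P B| <= pr P bad.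
  apply: pr_diff_le => //; apply/seteqP; split=> w /= [h nb]; split=> //.
    case/andP: h => /forallP hf /(CFw w nb) h; split=> // y ay.
    have yG : y \in G by rewrite inE mem_cat sE ay !orbT.
    have := hf [` GL _ yG]%fset; rewrite /e /= ay /= => /negbTE.
    by rewrite zeta.
  case: h => h1 h2; apply/andP; split; last exact/(CFw w nb).
  apply/forallP => y; apply/implyP => evy; have ay : adj E S k v (val y) := evy.
  rewrite zeta ?h2 //.
  by rewrite inE mem_cat sE ay !orbT.
have esym : symmetric e by move=> x y; exact: adj_sym.
have eirr : irreflexive e.
  by move=> x; apply/negP => /(adj_side S_part A1); case: side.
have osc1 : osc_le (fun c : {ffun L -> bool} => (C1 c)%:R : R) 1.
  move=> c c'; case: (C1 c); case: (C1 c'); rewrite ?subrr ?normr0 ?subr0 ?sub0r ?normrN ?normr1 //.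
(* As [v] is not in [F], the update at [v] leaves the event on [F] alone and occupies [v], if free,
   with probability [lam / (1 + lam)]. *)
have step c : heat_bath e lam [:: v'] (fun c => (C1 c)%:R) c = lam / (1 + lam) * (C2 c)%:R :> R.
  have CFu b : CF (update e v' b c) = CF c.
    apply: eq_forallb => x; rewrite /update ffunE.
    by case: eqP => // ->; rewrite /= (negbTE vF).
  rewrite /= /C1 !CFu /update !ffunE eqxx /= /C2.
  by ring.
have := heat_bath_dlr lam_gt0 esym eirr n v' init (@mem_volume_sites _ S k L) osc1.
rewrite (eq_heat_bath e lam _ init step) heat_bathZ -!/(hb _) -!przE mulr1.
set a := pr P A; set b := pr P B; set a' := pr P _; set b' := pr P _.
rewrite -/a -/a' in d1; rewrite -/b -/b' in d2.
have gn : (1 - (1 / (1 + lam)) ^+ size (volume_sites S k L)) ^+ n < eps by apply: hn0; lia.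
set q := lam / (1 + lam) in q0 q1 *; move=> d3.
have d2' : `|q * (b' - b)| <= pr P bad.
  rewrite normrM (ger0_norm q0); apply: le_trans d2.
  by rewrite ler_piMl.
rewrite (_ : a - q * b = - (a' - a) + (a' - q * b') + q * (b' - b)); last by ring.
apply: (le_trans (ler_normD _ _)); apply: (le_trans (lerD (ler_normD _ _) (lexx _))).
by rewrite normrN; lra.
Qed.

End Cylinders.

(** * Gibbs distributions *)

Lemma law_exists (R : realType) (d d' : measure_display) (Omega : measurableType d)
    (T : measurableType d') (P : probability Omega R) (X : Omega -> T) :
  measurable_fun setT X ->
  exists nu : probability T R, forall A, nu A = P (X @^-1` A).
Proof.
move=> mX.
pose X' : {mfun Omega >-> T} := HB.pack X (isMeasurableFun.Build _ _ _ _ X mX).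
by exists (distribution P X').
Qed.

Section Gibbs.
Variables (R : realType) (W : choiceType) (D : rel W) (lam : R).
Variable mu : probability (config W) R.
Hypothesis lam_gt0 : 0 < lam.
Hypothesis D_finite : forall v, exists s : seq W, forall w, (w \in s) = D v w.
Hypothesis D_irr : irreflexive D.

Let cyl (F : seq W) : set (config W) := [set eta : W -> bool | forall x, x \in F -> eta x].
Let vac (v : W) : set (config W) := [set eta : W -> bool | forall w, D v w -> eta w = false].

Hypothesis mu_cyl : forall v F, v \notin F ->
  mu (cyl (v :: F)) = ((lam / (1 + lam))%:E * mu (cyl F `&` vac v))%E.

(** Both sides of the integral identity are finite measures in [B]. They agree on cylinders avoiding
    [v], a pi-system generating the sigma-algebra of the other coordinates, hence on all of it. *)
Lemma gibbs_of_cylinders : is_gibbs D lam mu.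
Proof.
move=> v; set A := [set w | w != v].
set H := <<s occupied_events A >>.
have HC B : H B -> H (~` B).
  by move=> HB; apply: (@measurableC _ (g_sigma_algebraType (occupied_events A))).
have H0 : H set0 by apply: (@measurable0 _ (g_sigma_algebraType (occupied_events A))).
have HI B B' : H B -> H B' -> H (B `&` B').
  by move=> h h'; apply: (@measurableI _ (g_sigma_algebraType (occupied_events A))).
have HT : H setT by rewrite -setC0; exact: HC.
have Hsub : H `<=` @measurable _ (config W).
  apply: sub_smallest2r; first exact: smallest_sigma_algebra.
  by move=> _ [w Aw <-]; exists w.
have Hvac : H (vac v).
  have [s sE] := D_finite v.
  rewrite (_ : vac v = [set eta : W -> bool | forall w, w \in s -> eta w = false]); last first.
    by apply/seteqP; split=> eta h w; have := h w; rewrite sE.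
  have : {subset s <= [pred w | w != v]}.
    by move=> w; rewrite sE inE; apply: contraTneq => ->; rewrite D_irr.
  elim: s {sE} => [|w s IHs] sv.
    by rewrite (_ : mkset _ = setT) //; apply/seteqP; split.
  rewrite (_ : mkset _ = ~` [set eta : W -> bool | eta w] `&`
     [set eta : W -> bool | forall w, w \in s -> eta w = false]).
    apply: HI; last by apply: IHs => u us; apply: sv; rewrite inE us orbT.
    apply: HC; apply: sub_gen_smallest; exists w => //.
    by have := sv w; rewrite mem_head => /(_ isT).
  apply/seteqP; split=> eta /=.
    move=> h; split; first by rewrite h ?mem_head.
    by move=> u us; apply: h; rewrite inE us orbT.
  by move=> [/negP/negbTE h1 h2] u; rewrite inE => /orP[/eqP ->|/h2].
have mvac := Hsub _ Hvac.
have kerE eta : hardcore_kernel D lam v eta = lam / (1 + lam) * \1_(vac v) eta.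
  rewrite /hardcore_kernel indicE; case: asboolP => h.
    by rewrite mem_set ?mulr1.
  by rewrite memNset ?mulr0.
split.
  move=> B _; set q := lam / (1 + lam).
  have -> : hardcore_kernel D lam v @^-1` B =
     (vac v `&` [set _ | B q]) `|` (~` vac v `&` [set _ | B 0]).
    apply/seteqP; split=> eta /=; rewrite kerE indicE.
      have [vv|vv] := pselect (vac v eta).
        by rewrite mem_set // mulr1; left.
      by rewrite memNset // mulr0; right.
    by case=> -[vv]; [rewrite mem_set // mulr1 | rewrite memNset // mulr0].
  have Hc (Q : Prop) : H [set _ | Q].
    have [q0|q0] := pselect Q.
      by rewrite (_ : mkset _ = setT) //; apply/seteqP; split.
    by rewrite (_ : mkset _ = set0) //; apply/seteqP; split.
  apply: (@measurableU _ (g_sigma_algebraType (occupied_events A))).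
    by apply: HI; [exact: Hvac | exact: Hc].
  by apply: HI; [exact: HC | exact: Hc].
move=> B HB; have mB := Hsub _ HB.
have q0 : 0 <= lam / (1 + lam) by rewrite divr_ge0 // ltW // addr_gt0.
have mv : @measurable _ (config W) [set eta : W -> bool | eta v].
  by apply: sub_gen_smallest; exists v.
have -> : (\int[mu]_(t in B) (hardcore_kernel D lam v t)%:E =
   (lam / (1 + lam))%:E * mu (B `&` vac v))%E.
  under eq_integral do rewrite kerE EFinM.
  rewrite ge0_integralZl //; last first.
    by apply/measurable_EFinP; exact: measurable_indic.
  by rewrite integral_indic // setIC.
pose G := [set C : set (config W) | exists2 F : seq W, v \notin F & C = cyl F].
pose m1 := mrestr mu mv.
pose m2 := mscale (NngNum q0) (mrestr mu mvac).
suff : m1 B = m2 B by rewrite /m1 /m2 /mscale /mrestr /= setIC.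
have mcyl F : @measurable _ (config W) (cyl F).
  elim: F => [|w F IHF].
    by rewrite (_ : cyl _ = setT) //; apply/seteqP; split.
  rewrite (_ : cyl _ = [set eta : W -> bool | eta w] `&` cyl F).
    by apply: measurableI => //; apply: sub_gen_smallest; exists w.
  apply/seteqP; split=> eta /=.
    by move=> h; split; [apply: h; rewrite mem_head | move=> z zs; apply: h; rewrite inE zs orbT].
  by move=> [h1 h2] z; rewrite inE => /orP[/eqP ->|/h2].
have GT : G setT by exists [::] => //; apply/seteqP; split.
apply: (g_sigma_algebra_measure_unique G _ (fun=> setT)).
- by move=> _ [F _ ->].
- by [].
- by rewrite bigcup_const.
- move=> _ _ [F1 vF1 ->] [F2 vF2 ->]; exists (F1 ++ F2); first by rewrite mem_cat negb_or vF1.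
  apply/seteqP; split=> eta /=.
    by move=> [h1 h2] x; rewrite mem_cat => /orP[/h1|/h2].
  by move=> h; split=> x xF; apply: h; rewrite mem_cat xF ?orbT.
- move=> _ [F vF ->]; transitivity (mu (cyl (v :: F))); last exact: mu_cyl.
  rewrite /m1 /mrestr; congr (mu _).
  apply/seteqP; split=> eta /=.
    by move=> [h1 h2] x; rewrite inE => /orP[/eqP ->|/h1].
  by move=> h; split; [move=> x xF; apply: h; rewrite inE xF orbT | apply: h; rewrite mem_head].
- move=> _; rewrite /m1 /mrestr; apply: le_lt_trans (probability_le1 _ _) _; rewrite ?ltry //.
  exact: measurableI.
- move: HB; apply: sub_smallest2r; first exact: smallest_sigma_algebra.
  move=> _ [w Aw <-]; exists [:: w]; first by rewrite inE eq_sym.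
  by apply/seteqP; split=> eta /=; [move=> h x; rewrite inE => /eqP -> | apply; rewrite inE].
Qed.

End Gibbs.

Section Law.
Variables (R : realType) (V : choiceType) (E : rel V) (S : int -> set V).
Hypotheses (E_locfin : locally_finite E) (S_part : is_partition S) (A1 : condA1 E S)
  (A2 : condA2 E S).
Variables (d : measure_display) (Omega : measurableType d) (P : probability Omega R)
  (lam : R) (trap : Omega -> set V).
Hypothesis lam_gt0 : 0 < lam.
Hypothesis indep : independent_traps P (1 / (1 + lam)) trap.
Variables (W : choiceType) (D : rel W) (k : int) (f : W -> Dvertex S k).
Hypothesis f_iso : graph_iso D (@Dadj V E S k) f.

Let g w := val (f w).

(** The shift condition ranges over all candidates for [phi] because (A2) only asserts that one
    exists. Single-site marginals suffice for comparing the two codings. *)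
Lemma hvlim_gibbs (par : V -> bool) : alternating E par ->
  (forall phi, (forall x, lev S (phi x) = lev S x + 2) -> forall x, par (phi x) = par x) ->
  exists nu : probability (config W) R, is_gibbs D lam nu /\
    forall w, nu [set eta : W -> bool | eta w] = P [set o | hvlim E par (trap o) (g w)].
Proof.
move=> parE par_shift; have [phi [phi_aut phiS phi_out]] := A2.
have par_phi := par_shift phi (lev_phi S_part phiS).
have outs := locally_finite_out E_locfin; have ins := locally_finite_in E_locfin.
have [[h fK hK] fE] := f_iso.
have gs w : site S k (g w) by rewrite -in_Dvertex //; exact: valP.
have g_inj : injective g by move=> x y /val_inj; exact: can_inj fK _ _.
have g_surj x : site S k x -> exists w, g w = x.
  move=> sx; have hx : x \in S k `|` S (k + 1) by rewrite in_Dvertex.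
  by exists (h (exist _ x hx)); rewrite /g hK.
have gadj w w' : D w w' = adj E S k (g w) (g w') by rewrite -fE /Dadj /adj !gs.
pose X o : config W := fun w => hvlim E par (trap o) (g w).
have mX : measurable_fun setT X.
  apply: (@measurability _ _ _ (config W) setT X (occupied_events setT)) => // _ [_ [w _ <-] <-].
  by rewrite setTI; exact: measurable_hvlim indep outs (g w).
have [nu nuE] := law_exists P mX.
exists nu; split; last by move=> w; rewrite nuE.
apply: gibbs_of_cylinders => //.
- move=> w; have [s sE] := adj_finite S k outs ins (g w).
  exists [seq h' | h' <- pmap (fun x => omap h (insub x)) s] => w'.
  rewrite map_id gadj -sE mem_pmap; apply/mapP/idP.
    move=> [x xs]; case: insubP => //= u _ ux [->].
    by rewrite /g hK; have -> : val u = x := ux.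
  move=> gs'; exists (g w') => //.
  by rewrite /g valK /= fK.
- by move=> w; apply/negP; rewrite gadj => /(adj_side S_part A1); case: side.
move=> v F vF; rewrite !nuE.
have vF' : g v \notin map g F by rewrite mem_map.
have sF x : x \in map g F -> site S k x by move=> /mapP[w _ ->].
have := cylinder_dlr E_locfin S_part A1 phi_aut phiS phi_out parE par_phi
  lam_gt0 indep (gs v) sF vF'.
set A := [set w | _]; set B := _ `&` _; move=> AB.
rewrite (_ : X @^-1` _ = A); last first.
  apply/seteqP; split=> o /= H.
    move=> x; rewrite -(map_cons g) => /mapP[w wF ->]; exact: H.
  move=> w wF; apply: H; rewrite -(map_cons g); exact: map_f.
rewrite (_ : X @^-1` _ = B); last first.
  apply/seteqP; split=> o /= [H1 H2]; split.
  - by move=> x /mapP[w wF ->]; exact: H1.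
  - move=> y avy; have [w gw] : exists w, g w = y by apply: g_surj; case/and3P: avy.
    by rewrite -gw; apply: H2; rewrite gadj gw.
  - by move=> w wF; apply: H1; exact: map_f.
  - by move=> w Dvw; apply: H2; rewrite -gadj.
have mA : measurable A by exact: (measurable_occupied E_locfin par indep).
have mB : measurable B.
  apply: measurableI; first exact: (measurable_occupied E_locfin par indep).
  exact: (measurable_vacant S E_locfin k par indep).
by rewrite !prE // AB EFinM.
Qed.

End Law.

Theorem mainTheorem5 (R : realType) (V : choiceType) (E : rel V)
    (S : int -> set V) (E_locfin : locally_finite E) (S_part : is_partition S)
    (A1 : condA1 E S) (A2 : condA2 E S) :
  (forall k l : int, isomorphic (@Dadj V E S k) (@Dadj V E S l)) /\
  (forall (W : choiceType) (D : rel W) (lambda : R),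
     (forall k : int, isomorphic D (@Dadj V E S k)) ->
     0 < lambda ->
     unique_gibbs D lambda ->
     forall (d : measure_display) (Omega : measurableType d)
       (P : probability Omega R) (trap : Omega -> set V),
       independent_traps P (1 / (1 + lambda)) trap ->
       forall x : V,
         measurable [set omega | draw E (trap omega) x] /\
         P [set omega | draw E (trap omega) x] = 0%E).
Proof.
split; first exact: Dadj_isomorphic.
move=> W D lam Diso lam0 [mu [_ mu_uniq]] d Omega P trap indep x.
have outs := locally_finite_out E_locfin.
(* Normalised so that [x] lies on the 1-side, as [draw_hvlim] requires. *)
pose par y := lev_odd S y == lev_odd S x.
have px : par x by rewrite /par eqxx.
have parE : alternating E par.
  move=> y z /(lev_odd_alternating S_part A1); rewrite /par => ->.
  by case: (lev_odd S y); case: (lev_odd S x).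
have par_shift phi : (forall y, lev S (phi y) = lev S y + 2) ->
    forall y, par (phi y) = par y.
  by move=> lphi y; rewrite /par /lev_odd lphi; congr (_ == _); lia.
have parE' := alternatingN parE.
have par_shift' phi : (forall y, lev S (phi y) = lev S y + 2) ->
    forall y, (negb \o par) (phi y) = (negb \o par) y.
  by move=> lphi y /=; rewrite (par_shift _ lphi).
have [f f_iso] := Diso (lev S x).
have [nu [nuG nuE]] :=
  hvlim_gibbs E_locfin S_part A1 A2 lam0 indep f_iso parE par_shift.
have [nu' [nuG' nuE']] :=
  hvlim_gibbs E_locfin S_part A1 A2 lam0 indep f_iso parE' par_shift'.
have [w fwx] : exists w, val (f w) = x.
  have [[h fK hK] _] := f_iso.
  have hx : x \in S (lev S x) `|` S (lev S x + 1).
    by rewrite in_Dvertex // /site eqxx.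
  by exists (h (exist _ x hx)); rewrite hK.
set A := [set o | hvlim E par (trap o) x].
set A' := [set o | hvlim E (negb \o par) (trap o) x].
have PAA' : P A = P A'.
  have mw : @measurable _ (config W) [set eta : W -> bool | eta w].
    by apply: sub_gen_smallest; exists w.
  have := nuE w; have := nuE' w; rewrite fwx => <- <-.
  by rewrite !mu_uniq.
have mA : measurable A by exact: measurable_hvlim indep outs x.
have mA' : measurable A' by exact: measurable_hvlim indep outs x.
have A'A : A' `<=` A by move=> o; exact: hvlimN_le.
rewrite (_ : [set omega | draw E (trap omega) x] = A `&` ~` A'); last first.
  apply/seteqP; split=> o /=.
    by move=> /(draw_hvlim _ parE outs px)/andP[? /negP].
  by move=> [? /negP ?]; apply/(draw_hvlim _ parE outs px)/andP.
have mAA' : measurable (A `&` ~` A') by apply: measurableI => //; exact: measurableC.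
split=> //; rewrite prE //; congr EFin.
(* [A'] is contained in [A] and has the same probability, so the difference is null. *)
have := pr_split P mA mA'; rewrite (setIidr A'A) {1 2}/pr PAA' => h.
by apply: (addrI (fine (P A'))); rewrite addr0.
Qed.
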